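(* The non-trivial torsion pairs $(\mathcal{T},\mathcal{F})$ in $\mathrm{coh}\,\mathbb{P}^1$ are exactly the following: (a) $\mathcal{T}=\langle S_{\boldsymbol{x}}\mid\boldsymbol{x}\in P\rangle$ and $\mathcal{F}=\langle\mathcal{O}(m),S_{\boldsymbol{x}}\mid m\in\mathbb{Z},\ \boldsymbol{x}\in\mathbb{P}^1\setminus P\rangle$, where $P$ is a non-empty subset of $\mathbb{P}^1$; (b) $\mathcal{T}=\langle\mathcal{O}(m),S_{\boldsymbol{x}}\mid m>n,\ \boldsymbol{x}\in\mathbb{P}^1\rangle$ and $\mathcal{F}=\langle\mathcal{O}(m)\mid m\leq n\rangle$, where $n$ is an integer.
   Context: $\mathbf{k}$ is an algebraically closed field, $\mathbb{P}^1=\mathbb{P}^1_{\mathbf{k}}$ (also denoting its set of closed points), $\mathrm{coh}\,\mathbb{P}^1$ its category of coherent sheaves, $\mathcal{O}(n)$ the line bundle of degree $n$, and $S_{\boldsymbol{x}}$ the simple torsion sheaf at the closed point $\boldsymbol{x}$. All subcategories are full and closed under isomorphisms. $\langle\mathcal{S}\rangle$ denotes the smallest subcategory containing $\mathcal{S}$ and closed under extensions and direct summands. A torsion pair in an abelian category $\mathcal{A}$ is a pair $(\mathcal{T},\mathcal{F})$ of subcategories with $\mathrm{Hom}(\mathcal{T},\mathcal{F})=0$ such that every $Z\in\mathcal{A}$ admits an exact sequence $0\to X\to Z\to Y\to 0$ with $X\in\mathcal{T}$, $Y\in\mathcal{F}$. It is non-trivial if it is neither $(\mathcal{A},0)$ nor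 $(0,\mathcal{A})$. *)

(* Defs.v *)
(* Mathematical Components; boolp is used for the boolean reflection of a    *)
(* proposition.                                                              *)
From HB Require Import structures.
From mathcomp Require Import all_boot all_order all_algebra.
From mathcomp Require Import boolp.

Set Implicit Arguments.
Unset Strict Implicit.
Unset Printing Implicit Defensive.

Import GRing.Theory.

Local Open Scope ring_scope.

(* The projective line P^1 over k is covered by two affine charts            *)
(*   U0 = Spec k[t]  and  U1 = Spec k[s],  with s = 1/t on the overlap       *)
(*   U01 = Spec k[t, 1/t].                                                   *)
(* A quasi-coherent sheaf on P^1 is the same thing as its modules of         *)
(* sections over U0, U1 and U01 together with the two restriction maps to    *)
(* U01, which have to be localizations; it is coherent when the sections     *)
(* over U0 and U1 are finitely generated.  This is the standard gluing       *)
(* description of coh P^1.                                                   *)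
(* The polynomial variable 'X stands for t on U0, for s on U1 and for t on   *)
(* U01: a k[t, 1/t]-module is a k[t]-module on which t acts bijectively.     *)

Definition fin_gen (R : pzRingType) (M : lmodType R) : Prop :=
  exists (n : nat) (g : 'I_n -> M),
    forall m : M, exists c : 'I_n -> R, m = \sum_(i < n) c i *: g i.

Record coh (k : fieldType) := Coh {
  sec0 : lmodType {poly k};
  sec1 : lmodType {poly k};
  sec01 : lmodType {poly k};
  res0 : {linear sec0 -> sec01};
  res1 : {additive sec1 -> sec01};
  (* res1 is semilinear along k[s] -> k[t, 1/t], s |-> 1/t *)
  res1C : forall (c : k) (m : sec1), res1 (c%:P *: m) = c%:P *: res1 m;
  res1X : forall m : sec1, 'X *: res1 ('X *: m) = res1 m;
  sec01_bij : bijective (fun m : sec01 => 'X *: m);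
  (* res0 is the localization at t *)
  res0_ker : forall m : sec0, res0 m = 0 -> exists n, 'X^n *: m = 0;
  res0_im : forall z : sec01, exists n (m : sec0), 'X^n *: z = res0 m;
  (* res1 is the localization at s: s^n z = res1 m reads z = t^n res1 m *)
  res1_ker : forall m : sec1, res1 m = 0 -> exists n, 'X^n *: m = 0;
  res1_im : forall z : sec01, exists n (m : sec1), z = 'X^n *: res1 m;
  sec0_fg : fin_gen sec0;
  sec1_fg : fin_gen sec1
}.

Record coh_hom (k : fieldType) (E F : coh k) := CohHom {
  hom0 : {linear sec0 E -> sec0 F};
  hom1 : {linear sec1 E -> sec1 F};
  hom01 : {linear sec01 E -> sec01 F};
  hom_res0 : forall m, hom01 (res0 E m) = res0 F (hom0 m);
  hom_res1 : forall m, hom01 (res1 E m) = res1 F (hom1 m)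
}.

Section Category.
Variable k : fieldType.
Implicit Types E F G X Y Z : coh k.

Definition is_zero_hom E F (f : coh_hom E F) : Prop :=
  [/\ forall m, hom0 f m = 0, forall m, hom1 f m = 0 & forall m, hom01 f m = 0].

(* g after f is the identity of E *)
Definition left_inverse_hom E F (f : coh_hom E F) (g : coh_hom F E) : Prop :=
  [/\ cancel (hom0 f) (hom0 g), cancel (hom1 f) (hom1 g)
    & cancel (hom01 f) (hom01 g)].

Definition coh_iso E F : Prop :=
  exists (f : coh_hom E F) (g : coh_hom F E),
    left_inverse_hom f g /\ left_inverse_hom g f.

Definition is_zero_obj E : Prop :=
  [/\ forall m : sec0 E, m = 0, forall m : sec1 E, m = 0
    & forall m : sec01 E, m = 0].

(* Exactness of sheaves of modules: on sections over each affine open. *)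
Definition short_exact_seq (U V W : Type) (z : W) (f : U -> V) (g : V -> W) :=
  [/\ injective f, forall v, g v = z <-> exists u, f u = v
    & forall w, exists v, g v = w].

(* 0 -> X -> Z -> Y -> 0 *)
Definition short_exact X Z Y (f : coh_hom X Z) (g : coh_hom Z Y) : Prop :=
  [/\ short_exact_seq 0 (hom0 f) (hom0 g),
      short_exact_seq 0 (hom1 f) (hom1 g)
    & short_exact_seq 0 (hom01 f) (hom01 g)].

(* Z, with injections i, j and projections p, q, is the direct sum of X, Y *)
Definition is_biproduct X Y Z (i : coh_hom X Z) (j : coh_hom Y Z)
    (p : coh_hom Z X) (q : coh_hom Z Y) : Prop :=
  [/\ left_inverse_hom i p, left_inverse_hom j q
    & [/\ forall z, hom0 i (hom0 p z) + hom0 j (hom0 q z) = z,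
          forall z, hom1 i (hom1 p z) + hom1 j (hom1 q z) = z
        & forall z, hom01 i (hom01 p z) + hom01 j (hom01 q z) = z]].

Definition direct_summand X Z : Prop :=
  exists (Y : coh k) (i : coh_hom X Z) (j : coh_hom Y Z)
    (p : coh_hom Z X) (q : coh_hom Z Y), is_biproduct i j p q.

(* Full subcategories are predicates on objects that are closed under        *)
(* isomorphisms.                                                             *)
Definition iso_closed (C : coh k -> Prop) : Prop :=
  forall X Y, coh_iso X Y -> C X -> C Y.

Definition ext_closed (C : coh k -> Prop) : Prop :=
  forall X Z Y (f : coh_hom X Z) (g : coh_hom Z Y),
    short_exact f g -> C X -> C Y -> C Z.

Definition summand_closed (C : coh k -> Prop) : Prop :=
  forall X Z, direct_summand X Z -> C Z -> C X.

Definition same_objects (C D : coh k -> Prop) : Prop := forall X, C X <-> D X.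

Definition generated (S : coh k -> Prop) (X : coh k) : Prop :=
  forall C : coh k -> Prop,
    iso_closed C -> ext_closed C -> summand_closed C ->
    (forall Y, S Y -> C Y) -> C X.

Definition torsion_pair (T F : coh k -> Prop) : Prop :=
  [/\ iso_closed T, iso_closed F,
      forall X Y, T X -> F Y -> forall f : coh_hom X Y, is_zero_hom f
    & forall Z, exists (X Y : coh k) (f : coh_hom X Z) (g : coh_hom Z Y),
        [/\ T X, F Y & short_exact f g]].

Definition nontrivial_pair (T F : coh k -> Prop) : Prop :=
  ~ (same_objects T (fun=> True) /\ same_objects F is_zero_obj) /\
  ~ (same_objects T is_zero_obj /\ same_objects F (fun=> True)).

End Category.

(* The closed points of P^1 (k algebraically closed): [Some a] is the point  *)
(* t = a of U0, and [None] is the point at infinity, s = 0.                  *)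
Definition P1 (k : fieldType) : Type := option k.

Section Skyscraper.
Variable k : fieldType.

(* k^n as a {poly k}-module on which 'X acts as the scalar a *)
Definition eval_module (a : k) (n : nat) : Type := 'rV[k]_n.

Section EvalModule.
Variables (a : k) (n : nat).

HB.instance Definition _ := GRing.Zmodule.on (eval_module a n).

Let scale (p : {poly k}) (v : eval_module a n) : eval_module a n :=
  (p.[a] *: (v : 'rV[k]_n)).

Let scaleA p q v : scale p (scale q v) = scale (p * q) v.
Proof. by rewrite /scale hornerM scalerA. Qed.
Let scale1 : left_id 1 scale.
Proof. by move=> v; rewrite /scale hornerC scale1r. Qed.
Let scaleDr : right_distributive scale +%R.
Proof. by move=> p u v; rewrite /scale scalerDr. Qed.
Let scaleDl v : {morph scale^~ v : p q / p + q}.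
Proof. by move=> p q; rewrite /scale hornerD scalerDl. Qed.

HB.instance Definition _ :=
  GRing.Zmodule_isLmodule.Build {poly k} (eval_module a n)
    scaleA scale1 scaleDr scaleDl.

Lemma eval_scaleE (p : {poly k}) (v : eval_module a n) :
  p *: v = (p.[a] *: (v : 'rV[k]_n)) :> 'rV[k]_n.
Proof. by []. Qed.

End EvalModule.

(* membership of x in the charts, and the values t(x) on U0 and s(x) on U1   *)
(* (irrelevant when x is not in the chart)                                   *)
Definition in0 (x : P1 k) : bool := x != None.
Definition in1 (x : P1 k) : bool := x != Some 0.
Definition t_at (x : P1 k) : k := odflt 0 x.
Definition s_at (x : P1 k) : k := (t_at x)^-1.

(* k^b -> k^c, for b, c in {0, 1}: the identity of k when b = c = 1, and     *)
(* otherwise 0                                                               *)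
Definition restr (b c : bool) (v : 'rV[k]_b) : 'rV[k]_c := v *m const_mx 1.

Lemma restr_id (b : bool) (v : 'rV[k]_b) : restr b v = v.
Proof.
apply/rowP => i; rewrite /restr mxE.
case: b v i => v i; last by case: i.
by rewrite big_ord1 mxE mulr1; congr (v _ _); apply: val_inj; case: i => -[].
Qed.

Variable x : P1 k.

(* The sections of S_x over a chart U are k if x is in U, and 0 otherwise.   *)
Definition sky0 : lmodType {poly k} := eval_module (t_at x) (in0 x).
Definition sky1 : lmodType {poly k} := eval_module (s_at x) (in1 x).
Definition sky01 : lmodType {poly k} :=
  eval_module (t_at x) (in0 x && in1 x).

Definition sky_res0 (v : sky0) : sky01 :=
  restr (in0 x && in1 x) (v : 'rV[k]_(in0 x)).
Definition sky_res1 (v : sky1) : sky01 :=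
  restr (in0 x && in1 x) (v : 'rV[k]_(in1 x)).

Fact sky_res0_linear : linear sky_res0.
Proof.
move=> p u v; rewrite /sky_res0 /restr.
by rewrite [LHS]mulmxDl; congr (_ + _); rewrite [LHS]/= -[in LHS]scalemxAl.
Qed.
HB.instance Definition _ :=
  GRing.isLinear.Build {poly k} sky0 sky01 _ sky_res0 sky_res0_linear.

Fact sky_res1_additive : zmod_morphism sky_res1.
Proof. by move=> u v; rewrite /sky_res1 /restr; apply: mulmxBl. Qed.
HB.instance Definition _ :=
  GRing.isZmodMorphism.Build sky1 sky01 sky_res1 sky_res1_additive.

Fact sky_res1Z (p q : {poly k}) (c : k) (v : sky1) :
  c = p.[s_at x] -> c = q.[t_at x] -> sky_res1 (p *: v) = q *: sky_res1 v.
Proof.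
move=> cp cq; rewrite [LHS](_ : _ = (c *: v : 'rV[k]_(in1 x)) *m const_mx 1).
  by rewrite -[LHS]scalemxAl cq.
by rewrite cp.
Qed.

Lemma t_at_neq0 : in0 x && in1 x -> t_at x != 0.
Proof. by rewrite /in1; case: x => [a|] //= na0; apply: contraNneq na0 => ->. Qed.

Fact sky01_zero : in0 x && in1 x = false -> forall u v : sky01, u = v.
Proof.
move=> h u v; apply/rowP => -[i].
by move: (leqnn (i.+1)); rewrite {2}/in0 => _ ilt; exfalso; move: ilt; rewrite h.
Qed.

Fact sky_res1C (c : k) (m : sky1) :
  sky_res1 (c%:P *: m) = c%:P *: sky_res1 m.
Proof. by apply: (@sky_res1Z _ _ c); rewrite hornerC. Qed.

Fact sky_res1X (m : sky1) : 'X *: sky_res1 ('X *: m) = sky_res1 m.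
Proof.
case h: (in0 x && in1 x); last exact: sky01_zero.
rewrite (@sky_res1Z 'X (s_at x)%:P (s_at x)) ?hornerX ?hornerC // scalerA.
by rewrite [LHS]eval_scaleE !hornerE mulfV ?t_at_neq0 // scale1r.
Qed.

Fact sky01_bij : bijective (fun m : sky01 => 'X *: m).
Proof.
case h: (in0 x && in1 x); last by exists id => v; apply: sky01_zero.
have a0 := t_at_neq0 h.
by exists (fun m : sky01 => (t_at x)^-1%:P *: m) => v;
  rewrite scalerA [LHS]eval_scaleE !hornerE ?mulfV ?mulVf // scale1r.
Qed.

Fact restr_ker (b c : bool) (v : 'rV[k]_b) : (b -> c) -> restr c v = 0 -> v = 0.
Proof.
case: b c v => -[] v bc; rewrite ?restr_id //; first by have := bc isT.
by move=> _; apply/rowP => -[].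
Qed.

Fact sky_res0_ker (m : sky0) : sky_res0 m = 0 -> exists n, 'X^n *: m = 0.
Proof.
case h1: (in1 x) => eq0.
  exists 0; rewrite scale1r; apply: restr_ker eq0.
  by rewrite h1 andbT.
exists 1%N; rewrite [LHS]eval_scaleE hornerX.
have -> : t_at x = 0 by move/negbFE/eqP: h1 => ->.
by rewrite [LHS]scale0r.
Qed.

Fact sky_res1_ker (m : sky1) : sky_res1 m = 0 -> exists n, 'X^n *: m = 0.
Proof.
case h0: (in0 x) => eq0.
  by exists 0; rewrite scale1r; apply: restr_ker eq0; rewrite h0.
exists 1%N; rewrite [LHS]eval_scaleE hornerX.
have -> : s_at x = 0 by move/negbFE/eqP: h0; rewrite /s_at => ->; rewrite invr0.
by rewrite [LHS]scale0r.
Qed.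

Fact restr_surj (b c : bool) (w : 'rV[k]_c) :
  (c -> b) -> exists v : 'rV[k]_b, restr c v = w.
Proof.
case: b c w => -[] w cb; try by exists w; rewrite restr_id.
  by exists 0; apply/rowP => -[].
by have := cb isT.
Qed.

Fact sky_res0_im (z : sky01) : exists n (m : sky0), 'X^n *: z = sky_res0 m.
Proof.
have [|v vz] := @restr_surj (in0 x) _ z; first by case/andP.
by exists 0, v; rewrite scale1r -vz.
Qed.

Fact sky_res1_im (z : sky01) : exists n (m : sky1), z = 'X^n *: sky_res1 m.
Proof.
have [|v vz] := @restr_surj (in1 x) _ z; first by case/andP.
by exists 0, v; rewrite scale1r -vz.
Qed.

Fact eval_module_fg (a : k) (n : nat) : fin_gen (eval_module a n).
Proof.
exists n, (fun i => delta_mx 0 i) => m; exists (fun i => (m 0 i)%:P).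
rewrite [LHS](row_sum_delta (m : 'rV[k]_n)).
by apply: eq_bigr => i _; rewrite [RHS]eval_scaleE hornerC.
Qed.

(* the simple torsion sheaf at x *)
Definition skyscraper : coh k :=
  @Coh k sky0 sky1 sky01 sky_res0 sky_res1 sky_res1C sky_res1X sky01_bij
    sky_res0_ker sky_res0_im sky_res1_ker sky_res1_im
    (eval_module_fg _ _) (eval_module_fg _ _).

End Skyscraper.

Section LineBundle.
Variable k : fieldType.

Local Notation K := {fraction {poly k}}.
Local Notation "p %:F" := (@FracField.tofrac {poly k} p).
Local Notation t := ('X%:F : K).

(* k[t, 1/t] as a subring of k(t) *)
Definition laurent_pred : pred K :=
  fun f => `[< exists (N : nat) (p : {poly k}), f * t ^+ N = p%:F >].

Record laurent := Laurent { laurent_val : K; _ : laurent_pred laurent_val }.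

HB.instance Definition _ := [isSub for laurent_val].
HB.instance Definition _ := [Choice of laurent by <:].

Fact laurent_zmod_closed : zmod_closed laurent_pred.
Proof.
split; first by apply/asboolP; exists 0, 0; rewrite mul0r tofrac0.
move=> f g /asboolP[N [p fp]] /asboolP[M [q gq]]; apply/asboolP.
exists (N + M), (p * 'X^M - q * 'X^N).
rewrite tofracB !tofracM !tofracXn -fp -gq exprD mulrBl.
by congr (_ - _); rewrite -!mulrA // [t ^+ M * _]mulrC.
Qed.
HB.instance Definition _ :=
  GRing.isZmodClosed.Build K laurent_pred laurent_zmod_closed.
HB.instance Definition _ := [SubChoice_isSubZmodule of laurent by <:].

Fact laurentM (p : {poly k}) (f : laurent) : laurent_pred (p%:F * val f).
Proof.
apply/asboolP; case/asboolP: (valP f) => N [q fq].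
by exists N, (p * q); rewrite -mulrA fq tofracM.
Qed.

Let scale (p : {poly k}) (f : laurent) : laurent := Laurent (laurentM p f).

Let scaleA p q f : scale p (scale q f) = scale (p * q) f.
Proof. by apply: val_inj; rewrite /= mulrA tofracM. Qed.
Let scale1 : left_id 1 scale.
Proof. by move=> f; apply: val_inj; rewrite /= tofrac1 mul1r. Qed.
Let scaleDr : right_distributive scale +%R.
Proof. by move=> p f g; apply: val_inj; rewrite /= mulrDr. Qed.
Let scaleDl f : {morph scale^~ f : p q / p + q}.
Proof. by move=> p q; apply: val_inj; rewrite /= tofracD mulrDl. Qed.

HB.instance Definition _ :=
  GRing.Zmodule_isLmodule.Build {poly k} laurent
    scaleA scale1 scaleDr scaleDl.

Lemma laurent_scaleE (p : {poly k}) (f : laurent) : val (p *: f) = p%:F * val f.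
Proof. by []. Qed.

Lemma t_neq0 : t != 0.
Proof. by rewrite tofrac_eq0 polyX_eq0. Qed.

(* p(1/t) *)
Definition at_tinv (p : {poly k}) : K :=
  (map_poly (@FracField.tofrac {poly k} \o polyC) p).[t^-1].

Lemma at_tinvE n (p : {poly k}) : (size p <= n)%N ->
  at_tinv p = \sum_(i < n) (p`_i)%:P%:F * t ^- i.
Proof.
move=> pn; rewrite /at_tinv (@horner_coef_wide _ n); last first.
  exact: leq_trans (size_poly _ _) pn.
by apply: eq_bigr => i _; rewrite coef_map /= exprVn.
Qed.

Lemma at_tinvB : zmod_morphism at_tinv.
Proof. by move=> p q; rewrite /at_tinv rmorphB /= hornerD hornerN. Qed.

Lemma at_tinvM p q : at_tinv (p * q) = at_tinv p * at_tinv q.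
Proof. by rewrite /at_tinv rmorphM /= hornerM. Qed.

Lemma at_tinvC c : at_tinv c%:P = c%:P%:F.
Proof. by rewrite /at_tinv map_polyC hornerC. Qed.

Lemma at_tinvX : at_tinv 'X = t^-1.
Proof. by rewrite /at_tinv map_polyX hornerX. Qed.

Lemma tofracE n (p : {poly k}) : (size p <= n)%N ->
  p%:F = \sum_(i < n) (p`_i)%:P%:F * t ^+ i.
Proof.
move=> pn; rewrite -[in LHS](coefK p) (poly_def (size p)).
rewrite (big_ord_widen_cond n predT (fun i => p`_i *: 'X^i)) //.
rewrite big_mkcond rmorph_sum; apply: eq_bigr => i _ /=.
case: ltnP => [_|ip]; first by rewrite -mul_polyC rmorphM rmorphXn.
by rewrite nth_default // rmorph0 mul0r.
Qed.

(* t^d p(1/t), for d at least the size of p *)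
Definition rev_poly (d : nat) (p : {poly k}) : {poly k} :=
  \poly_(i < d.+1) p`_(d - i).

Lemma rev_polyE d (p : {poly k}) : (size p <= d)%N -> t ^+ d * at_tinv p = (rev_poly d p)%:F.
Proof.
move=> pd; rewrite (@at_tinvE d.+1) ?(leq_trans pd) //.
rewrite [RHS](@tofracE d.+1) ?size_poly //.
rewrite [in LHS](reindex_inj rev_ord_inj) /= mulr_sumr.
apply: eq_bigr => i _; rewrite coef_poly subSS ltn_ord mulrCA; congr (_ * _).
have id : (i <= d)%N by rewrite -ltnS.
by rewrite -{1}(subnK id) exprD [t ^+ (d - i) * _]mulrC mulfK ?expf_neq0 ?t_neq0.
Qed.

Variable n : int.

(* O(n) is glued from the free modules k[t] e0 and k[s] e1 by e1 = t^n e0,   *)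
(* so that its global sections are the polynomials in t of degree <= n.      *)
Fact line_res0_laurent (p : {poly k}) : laurent_pred p%:F.
Proof. by apply/asboolP; exists 0, p; rewrite mulr1. Qed.

Fact shift_exists (m : nat) :
  exists N d : nat, (m <= d)%N /\ n + N%:Z = d%:Z.
Proof.
case: n => a.
  by exists m, (a + m)%N; split; [exact: leq_addl | rewrite PoszD].
exists (a.+1 + m)%N, m; split=> //.
by rewrite NegzE PoszD addrA addNr add0r.
Qed.

Fact line_res1_laurent (p : {poly k}) : laurent_pred (t ^ n * at_tinv p).
Proof.
have [N [d [pd nN]]] := shift_exists (size p).
apply/asboolP; exists N, (rev_poly d p).
by rewrite -rev_polyE // mulrAC [t ^+ N]exprnP -expfzDr ?t_neq0 // nN -exprnP.
Qed.

Definition line_res0 (p : {poly k}^o) : laurent := Laurent (line_res0_laurent p).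
Definition line_res1 (p : {poly k}^o) : laurent := Laurent (line_res1_laurent p).

Fact line_res0_linear : linear line_res0.
Proof. by move=> p u v; apply: val_inj; rewrite /= tofracD tofracM. Qed.
HB.instance Definition _ :=
  GRing.isLinear.Build {poly k} {poly k}^o laurent _ line_res0 line_res0_linear.

Fact line_res1_additive : zmod_morphism line_res1.
Proof. by move=> u v; apply: val_inj; rewrite /= at_tinvB mulrBr. Qed.
HB.instance Definition _ :=
  GRing.isZmodMorphism.Build {poly k}^o laurent line_res1 line_res1_additive.

Fact line_res1C (c : k) (m : {poly k}^o) :
  line_res1 (c%:P *: m) = c%:P *: line_res1 m.
Proof. by apply: val_inj; rewrite /= at_tinvM at_tinvC mulrCA. Qed.

Fact line_res1X (m : {poly k}^o) : 'X *: line_res1 ('X *: m) = line_res1 m.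
Proof.
apply: val_inj; rewrite /= at_tinvM at_tinvX [t^-1 * _]mulrC !mulrA.
by rewrite mulrC !mulrA mulVf ?t_neq0 // mul1r.
Qed.

Fact laurent_tinvM (f : laurent) : laurent_pred (t^-1 * val f).
Proof.
apply/asboolP; case/asboolP: (valP f) => N [q fq].
exists N.+1, q; rewrite exprS -fq mulrACA mulVf ?t_neq0 // mul1r //.
Qed.

Fact laurent_bij : bijective (fun f : laurent => 'X *: f).
Proof.
exists (fun f => Laurent (laurent_tinvM f)) => f; apply: val_inj => /=;
  by rewrite mulrA ?mulVf ?mulfV ?t_neq0 // mul1r.
Qed.

Fact line_res0_ker (m : {poly k}^o) :
  line_res0 m = 0 -> exists N, 'X^N *: m = 0.
Proof.
move/(congr1 val)/eqP; rewrite /= tofrac_eq0 => /eqP ->.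
by exists 0; rewrite scaler0.
Qed.

Fact line_res0_im (z : laurent) :
  exists N (m : {poly k}^o), 'X^N *: z = line_res0 m.
Proof.
case/asboolP: (valP z) => N [q zq]; exists N, q.
by apply: val_inj; rewrite /= tofracXn mulrC.
Qed.

Fact line_res1_ker (m : {poly k}^o) :
  line_res1 m = 0 -> exists N, 'X^N *: m = 0.
Proof.
move/(congr1 val)/eqP; rewrite /= mulf_eq0 expfz_eq0 (negbTE t_neq0) andbF /=.
move=> /eqP m0; exists 0; rewrite scale1r; apply/polyP => i; rewrite coef0.
have := rev_polyE (leqnn (size m)); rewrite m0 mulr0 => /esym/eqP.
rewrite tofrac_eq0 => /eqP/polyP/(_ (size m - i)%N).
rewrite coef_poly coef0 ltnS leq_subr.
case: (leqP (size m) i) => [im _|im]; first by rewrite nth_default.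
by rewrite subKn // ltnW.
Qed.

Fact line_res1_im (z : laurent) :
  exists N (m : {poly k}^o), z = 'X^N *: line_res1 m.
Proof.
case/asboolP: (valP z) => M [q zq].
have [N [d [qd nN]]] := shift_exists (size q).
have qd' : (size q <= M + d)%N by rewrite (leq_trans qd) ?leq_addl.
have rqd : (size (rev_poly (M + d) q) <= (M + d).+1)%N by apply: size_poly.
exists N, (rev_poly (M + d) q); apply: val_inj.
rewrite /= tofracXn mulrA [t ^+ N]exprnP -expfzDr ?t_neq0 //.
rewrite [N%:Z + n]addrC nN -exprnP.
have tM0 : t ^+ M != 0 by rewrite expf_neq0 ?t_neq0.
apply: (mulIf tM0); rewrite zq mulrAC -exprD addnC.
rewrite (@at_tinvE (M + d).+1) // [LHS](@tofracE (M + d).+1) ?(leq_trans qd') //.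
rewrite [in RHS](reindex_inj rev_ord_inj) /= mulr_sumr.
apply: eq_bigr => i _; have id : (i <= M + d)%N by rewrite -ltnS.
rewrite coef_poly !subSS ltnS leq_subr subKn // mulrCA; congr (_ * _).
rewrite -[X in t ^+ X * _](subnKC id) exprD mulfK //.
by rewrite expf_neq0 ?t_neq0.
Qed.

Fact regular_fg : fin_gen ({poly k}^o : lmodType {poly k}).
Proof.
exists 1, (fun=> 1) => m; exists (fun=> m).
by rewrite big_ord1 [RHS]mulr1.
Qed.

(* the line bundle of degree n *)
Definition line_bundle : coh k :=
  @Coh k {poly k}^o {poly k}^o laurent line_res0 line_res1
    line_res1C line_res1X laurent_bij line_res0_ker line_res0_im
    line_res1_ker line_res1_im regular_fg regular_fg.

End LineBundle.

(* Main.v *)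
From HB Require Import structures.
Require Import Defs.
From mathcomp Require Import all_boot all_order all_algebra.
From mathcomp Require Import boolp zify.

(* A morphism from O(n) to E is a pair of sections y0, y1 over the two charts
   with y1 = t^n y0, and E contains the skyscraper at x exactly when it has an
   eigenvector of the coordinate at x; such an eigenvector also gives nonzero
   morphisms from every O(n).  Let Y be nonzero with Hom(O(n), Y) = 0 and let l
   be maximal with Hom(O(l), Y) nonzero.  Then O(l) embeds in Y, and as
   H^1(O(-1)) = 0 the quotient Y' has Hom(O(l + 1), Y') = 0; by Noetherian
   induction Y is an iterated extension of line bundles of degree < n.
   Torsion-free sheaves in general are reduced to this by splitting off the
   saturation of a line subbundle, whose sections have bounded degree.  This
   yields the two families of torsion pairs.  Conversely, for a torsion pair
   (T, F), each simple sheaf lies in T or in F, every line bundle of degree at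
   least that of one in T is in T, and a line bundle such that no line bundle
   of smaller or equal degree is in T lies in F, because its nonzero subsheaves
   are line bundles.  So (T, F) contains a pair of the list, hence equals it. *)

Set Implicit Arguments.
Unset Strict Implicit.
Unset Printing Implicit Defensive.

Import Order.TTheory GRing.Theory Num.Theory.

Local Open Scope ring_scope.

(** * Submodules and quotient modules *)


(** The proof uses neither the splitting of vector bundles nor rank, degree or Ext groups. All
    classes involved are closed under extensions, so it is enough to exhibit sheaves as iterated
    extensions, and the largest subobject of a given kind is replaced by induction over proper
    quotients. The obstacle is to control the quotient of Y by a line subbundle O(l): for arbitrary
    l it may have torsion, or morphisms from line bundles of larger degree. Maximality of l and the
    splitting of Laurent polynomials deal with both when the degrees of morphisms into Y are
    bounded. For a general torsion-free Y this is applied to the saturation of O(l), and its bound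
    comes from clearing denominators on the two charts. The overlap is a localization of each chart,
    so identities there are tested after multiplication by powers of t. *)

Section SubQuotientModules.
Variable R : nzRingType.

Section Kernel.
Variables (M N : lmodType R) (f : {linear M -> N}).

Definition ker_pred : pred M := fun m => f m == 0.

Record ker_mod := KerMod { ker_val : M; _ : ker_pred ker_val }.

HB.instance Definition _ := [isSub for ker_val].
HB.instance Definition _ := [Choice of ker_mod by <:].

Fact ker_submod_closed : submod_closed ker_pred.
Proof.
split; first by rewrite /ker_pred unfold_in linear0.
move=> a u v; rewrite /ker_pred !unfold_in => /eqP fu /eqP fv.
by rewrite linearP fu fv scaler0 addr0.
Qed.
HB.instance Definition _ :=
  GRing.isSubmodClosed.Build R M ker_pred ker_submod_closed.
HB.instance Definition _ := [SubChoice_isSubLmodule of ker_mod by <:].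

End Kernel.

Section Cokernel.
Variables (M N : lmodType R) (f : {linear M -> N}).

Definition img_pred : pred N := fun n => `[< exists m, f m = n >].

Fact img_zmod_closed : zmod_closed img_pred.
Proof.
split; first by apply/asboolP; exists 0; rewrite linear0.
move=> _ _ /asboolP[u <-] /asboolP[v <-]; apply/asboolP.
by exists (u - v); rewrite linearB.
Qed.
HB.instance Definition _ := GRing.isZmodClosed.Build N img_pred img_zmod_closed.

Definition img_closed : zmodClosed N := GRing.ZmodClosed.clone N img_pred _.

Definition coker_mod : Type := Quotient.quot img_closed.

HB.instance Definition _ := GRing.Zmodule.on coker_mod.

Definition coker_pi (n : N) : coker_mod := \pi_(Quotient.quot img_closed)%qT n.

Fact coker_pi_additive : zmod_morphism coker_pi.
Proof. by move=> u v; rewrite /coker_pi; exact: (raddfB (\pi_(Quotient.quot img_closed)%qT)). Qed.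
HB.instance Definition _ := GRing.isZmodMorphism.Build N coker_mod coker_pi coker_pi_additive.

Lemma coker_piP u v : coker_pi u = coker_pi v <-> exists m, f m = u - v.
Proof.
split=> [/eqP|uv]; rewrite /coker_pi.
  by rewrite -Quotient.idealrBE => /asboolP.
by apply/eqP; rewrite -Quotient.idealrBE; apply/asboolP.
Qed.

Lemma coker_pi0 u : coker_pi u = 0 <-> exists m, f m = u.
Proof. by rewrite -[X in _ = X](raddf0 coker_pi) coker_piP subr0. Qed.

Lemma coker_pi_surj w : exists v, coker_pi v = w.
Proof. by exists (repr w); rewrite /coker_pi reprK. Qed.

(** The quotient is formed as an abelian group, so scalars act through chosen representatives;
    [coker_scale_pi] shows that the choice does not matter. *)
Definition coker_scale (a : R) (w : coker_mod) : coker_mod := coker_pi (a *: repr w).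

Lemma coker_scale_pi a v : coker_scale a (coker_pi v) = coker_pi (a *: v).
Proof.
apply/coker_piP; have : coker_pi (repr (coker_pi v)) = coker_pi v.
  by rewrite /coker_pi reprK.
by case/coker_piP=> m fm; exists (a *: m); rewrite linearZ /= fm scalerBr.
Qed.

Fact coker_scaleA a b w : coker_scale a (coker_scale b w) = coker_scale (a * b) w.
Proof. by have [v <-] := coker_pi_surj w; rewrite !coker_scale_pi scalerA. Qed.
Fact coker_scale1 : left_id 1 coker_scale.
Proof. by move=> w; have [v <-] := coker_pi_surj w; rewrite !coker_scale_pi scale1r. Qed.
Fact coker_scaleDr : right_distributive coker_scale +%R.
Proof.
move=> a w w'; have [v <-] := coker_pi_surj w; have [v' <-] := coker_pi_surj w'.
by rewrite -raddfD !coker_scale_pi scalerDr raddfD.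
Qed.
Fact coker_scaleDl w : {morph coker_scale^~ w : a b / a + b}.
Proof.
by move=> a b; have [v <-] := coker_pi_surj w; rewrite !coker_scale_pi scalerDl raddfD.
Qed.
HB.instance Definition _ :=
  GRing.Zmodule_isLmodule.Build R coker_mod
    coker_scaleA coker_scale1 coker_scaleDr coker_scaleDl.

Fact coker_pi_scalable : scalable coker_pi.
Proof. by move=> a v; rewrite -coker_scale_pi. Qed.
HB.instance Definition _ := GRing.isScalable.Build R N coker_mod _ coker_pi coker_pi_scalable.

End Cokernel.
End SubQuotientModules.

(** * Gluing morphisms on the two charts *)


Section Sheaves.
Variable k : fieldType.
Implicit Types E F G W X Y Z : coh k.

Lemma linear_scale (M N : lmodType {poly k}) (f : {linear M -> N}) (p : {poly k}) m :
  f (p *: m) = p *: f m.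
Proof. exact: linearZ. Qed.

Lemma scaleCA (M : lmodType {poly k}) (p q : {poly k}) (m : M) :
  p *: (q *: m) = q *: (p *: m).
Proof. by rewrite !scalerA mulrC. Qed.

Section TwistOperator.
Variable E : coh k.
Implicit Types (z w : sec01 E).

Lemma sec01_Xn_inj n : injective (fun z => 'X^n *: z : sec01 E).
Proof.
elim: n => [|n IH] z w; first by rewrite !scale1r.
rewrite !exprS -!scalerA => eqX; apply: IH.
exact: (bij_inj (sec01_bij E)) eqX.
Qed.

Lemma sec01_Xn_surj n z : exists w, 'X^n *: w = z.
Proof.
elim: n z => [|n IH] z; first by exists z; rewrite scale1r.
have [w <-] := IH z; have [g _ gK] := sec01_bij E.
by exists (g w); rewrite exprSr -scalerA gK.
Qed.

(* multiplication by [t ^ n], also for [n < 0] *)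
Definition twist (n : int) z : sec01 E :=
  match n with
  | Posz a => 'X^a *: z
  | Negz a => projT1 (cid (sec01_Xn_surj a.+1 z))
  end.

Lemma twistP (n : int) (a b : nat) z w : a%:Z = b%:Z + n ->
  twist n z = w <-> 'X^a *: z = 'X^b *: w.
Proof.
case: n => c /= abn.
  have -> : a = (b + c)%N by lia.
  rewrite exprD -scalerA; split=> [<- //|]; exact: sec01_Xn_inj.
case: cid => u /= uz; have -> : b = (a + c.+1)%N by lia.
rewrite -uz scalerA -exprD; split=> [<- //|]; exact: sec01_Xn_inj.
Qed.

Lemma twist_witness (n : int) : exists a b : nat, a%:Z = b%:Z + n.
Proof.
case: n => c; first by exists c, 0.
by exists 0, c.+1; lia.
Qed.

Lemma twist_is_linear n : linear (twist n).
Proof.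
move=> p u v; have [a [b abn]] := twist_witness n.
apply/(twistP _ _ abn); rewrite !scalerDr !scalerA ![_ * p]mulrC -!scalerA.
by congr (_ *: _ + _); apply/(twistP _ _ abn).
Qed.
HB.instance Definition _ n :=
  GRing.isLinear.Build {poly k} (sec01 E) (sec01 E) _ (twist n) (twist_is_linear n).

Lemma twistX (n : int) (a b : nat) z : a%:Z = b%:Z + n -> 'X^b *: twist n z = 'X^a *: z.
Proof. by move=> abn; symmetry; apply/(twistP _ _ abn). Qed.

Lemma twistD m n z : twist (m + n) z = twist m (twist n z).
Proof.
have [a [b abn]] := twist_witness n; have [c [d cdm]] := twist_witness m.
apply/(@twistP _ (a + c) (b + d)); first by lia.
by rewrite !exprD -!scalerA (twistX _ cdm) [RHS]scaleCA (twistX _ abn) scaleCA.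
Qed.

Lemma twist_nat (n : nat) z : twist n z = 'X^n *: z. Proof. by []. Qed.

Lemma twist0 z : twist 0 z = z. Proof. exact: scale1r. Qed.

Lemma twist_inj n : injective (twist n).
Proof. by move=> u v uv; rewrite -[u]twist0 -[v]twist0 -(addNr n) !twistD uv. Qed.

Lemma twist1V z : twist (- 1) ('X *: z) = z.
Proof. by rewrite -[X in _ (X *: z)]expr1 -twist_nat -twistD addNr twist0. Qed.

Lemma twistV1X z : 'X *: twist (- 1) z = z.
Proof. by rewrite -[X in X *: _]expr1 (@twistX _ 0 1) // expr0 scale1r. Qed.

Lemma res1_X m : res1 E ('X *: m) = twist (- 1) (res1 E m).
Proof. by rewrite -[in RHS](res1X m) twist1V. Qed.

Lemma res1_Xn n m : 'X^n *: res1 E ('X^n *: m) = res1 E m.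
Proof.
elim: n m => [|n IH] m; first by rewrite !scale1r.
by rewrite exprSr -!scalerA [_ *: ('X *: m)]scaleCA res1X.
Qed.

(* This is [p (t) = t ^ d * q (1/t)] for [q = rev_poly d p]. *)
Lemma scale_res1 (p : {poly k}) d m : (size p <= d.+1)%N ->
  p *: res1 E m = 'X^d *: res1 E (rev_poly d p *: m).
Proof.
move=> pd; rewrite -[in LHS](coefK p) poly_def.
rewrite (big_ord_widen_cond d.+1 predT (fun i => p`_i *: 'X^i)) // big_mkcond /=.
rewrite /rev_poly poly_def [in RHS](reindex_inj rev_ord_inj) /= !scaler_suml raddf_sum scaler_sumr.
apply: eq_bigr => i _; have id : (i <= d)%N by rewrite -ltnS.
rewrite subSS subKn // -!mul_polyC -!scalerA res1C.
(* In the i-th term t^(d - i) cancels the s^(d - i) inside [res1], which leaves t^i. *)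
have -> : 'X^d = 'X^i * 'X^(d - i) :> {poly k} by rewrite -exprD subnKC.
rewrite -[RHS]scalerA [_ *: (_%:P *: _)]scaleCA res1_Xn.
case: ltnP => [_|ip]; first by rewrite scaleCA scalerA.
by rewrite nth_default // !scale0r scaler0.
Qed.

End TwistOperator.

(* pairs of sections gluing to a morphism from the line bundle of degree n *)
Definition sect E (n : int) (y0 : sec0 E) (y1 : sec1 E) : Prop :=
  res1 E y1 = twist n (res0 E y0).

(** Clearing the pole at t = 0 completes a section over U1 to a morphism from some O(-n). This
    supplies matching sections in [glue_hom1] and nonzero morphisms in [exists_sect]. *)
Lemma res0_im_sect E (y1 : sec1 E) : exists (n : nat) (y0 : sec0 E), sect (- n%:Z) y0 y1.
Proof.
have [n [y0 e]] := res0_im (res1 E y1); exists n, y0.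
by symmetry; rewrite /sect; apply/(@twistP _ _ 0 n); rewrite ?addrN // -e scale1r.
Qed.

Lemma res1_im_sect E (y0 : sec0 E) : exists (n : nat) (y1 : sec1 E), sect (- n%:Z) y0 y1.
Proof.
have [n [y1 e]] := res1_im (res0 E y0); exists n, y1.
by symmetry; rewrite /sect; apply/(@twistP _ _ 0 n); rewrite ?addrN // -e scale1r.
Qed.

Lemma res0Z E (p : {poly k}) y : res0 E (p *: y) = p *: res0 E y.
Proof. exact: linear_scale. Qed.

Lemma res0D E u v : res0 E (u + v) = res0 E u + res0 E v.
Proof. exact: raddfD. Qed.

Lemma hom0Z E F (f : coh_hom E F) (p : {poly k}) m : hom0 f (p *: m) = p *: hom0 f m.
Proof. exact: linear_scale. Qed.
Lemma hom1Z E F (f : coh_hom E F) (p : {poly k}) m : hom1 f (p *: m) = p *: hom1 f m.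
Proof. exact: linear_scale. Qed.
Lemma hom01Z E F (f : coh_hom E F) (p : {poly k}) m : hom01 f (p *: m) = p *: hom01 f m.
Proof. exact: linear_scale. Qed.
Lemma hom0B E F (f : coh_hom E F) u v : hom0 f (u - v) = hom0 f u - hom0 f v.
Proof. exact: raddfB. Qed.
Lemma hom1B E F (f : coh_hom E F) u v : hom1 f (u - v) = hom1 f u - hom1 f v.
Proof. exact: raddfB. Qed.
Lemma hom01B E F (f : coh_hom E F) u v : hom01 f (u - v) = hom01 f u - hom01 f v.
Proof. exact: raddfB. Qed.
Lemma hom0_0 E F (f : coh_hom E F) : hom0 f 0 = 0. Proof. exact: raddf0. Qed.
Lemma hom1_0 E F (f : coh_hom E F) : hom1 f 0 = 0. Proof. exact: raddf0. Qed.
Lemma hom01_0 E F (f : coh_hom E F) : hom01 f 0 = 0. Proof. exact: raddf0. Qed.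

Section Glue.
Variables (E F : coh k) (f0 : {linear sec0 E -> sec0 F}) (f1 : {linear sec1 E -> sec1 F}).
Hypothesis f01 : forall n y0 y1, sect n y0 y1 -> sect n (f0 y0) (f1 y1).

(** Graph of the localization of [f0] at t: the fraction y / t^n goes to f0 y / t^n. It is a
    relation because [sec01] is a localization by its properties and not as a set of fractions. *)
Definition glue_rel (z : sec01 E) (w : sec01 F) : Prop :=
  exists (n : nat) y0, 'X^n *: z = res0 E y0 /\ 'X^n *: w = res0 F (f0 y0).

Let f0Z := linear_scale f0.
Let f0D u v : f0 (u + v) = f0 u + f0 v := raddfD f0 u v.

Lemma glue_res0 u v : res0 E u = res0 E v -> res0 F (f0 u) = res0 F (f0 v).
Proof.
move=> uv; have /res0_ker[n] : res0 E (u - v) = 0 by rewrite linearB /= uv subrr.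
move=> /(congr1 (res0 F \o f0)) /=; rewrite f0Z res0Z !raddf0 => e.
apply/eqP; rewrite -subr_eq0 -!linearB /=; apply/eqP.
by apply: (@sec01_Xn_inj _ n); rewrite e scaler0.
Qed.

Lemma glue_rel_fun z w w' : glue_rel z w -> glue_rel z w' -> w = w'.
Proof.
move=> [n [y [zy wy]]] [n' [y' [zy' wy']]].
apply: (@sec01_Xn_inj _ (n + n')); rewrite /= exprD -[in RHS]scalerA wy'.
rewrite mulrC -scalerA wy -!res0Z -!f0Z; apply: glue_res0.
by rewrite !res0Z -zy -zy' scaleCA.
Qed.

Lemma glue_rel_total z : exists w, glue_rel z w.
Proof.
have [n [y e]] := res0_im z; have [w wy] := sec01_Xn_surj n (res0 F (f0 y)).
by exists w, n, y.
Qed.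

Definition glue (z : sec01 E) : sec01 F := projT1 (cid (glue_rel_total z)).

Lemma glueP z w : glue_rel z w -> glue z = w.
Proof. by rewrite /glue; case: cid => w' /= r' r; exact: glue_rel_fun r' r. Qed.

Lemma glue_is_linear : linear glue.
Proof.
move=> p u v; apply: glueP; rewrite /glue.
case: cid => u' [n [y [uy uy']]]; case: cid => v' [m [x [vx vx']]] /=.
exists (n + m)%N, ('X^m *: (p *: y) + 'X^n *: x).
have XX (M : lmodType {poly k}) (r : M) :
    'X^(n + m) *: (p *: r) = 'X^m *: (p *: ('X^n *: r)).
  by rewrite exprD -scalerA scaleCA ['X^n *: (p *: r)]scaleCA.
split; rewrite scalerDr XX ?uy ?uy' ?f0D res0D ?f0Z !res0Z; congr (_ + _).
  by rewrite -vx exprD scalerA.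
by rewrite -vx' exprD scalerA.
Qed.
HB.instance Definition _ :=
  GRing.isLinear.Build {poly k} (sec01 E) (sec01 F) _ glue glue_is_linear.

Lemma glue_hom0 m : glue (res0 E m) = res0 F (f0 m).
Proof. by apply: glueP; exists 0, m; rewrite !scale1r. Qed.

Lemma glue_hom1 m : glue (res1 E m) = res1 F (f1 m).
Proof.
(* The partner [y] of [m] represents [res1 E m] as y / t^n, and [f01] carries this relation over to
   F. *)
have [n [y s]] := res0_im_sect m; apply: glueP; exists n, y.
by rewrite s (f01 s) -!twist_nat -!twistD addrN !twist0.
Qed.

Definition glue_hom : coh_hom E F := @CohHom k E F f0 f1 glue glue_hom0 glue_hom1.

End Glue.

Lemma hom_sect E F (f : coh_hom E F) n y0 y1 :
  sect n y0 y1 -> sect n (hom0 f y0) (hom1 f y1).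
Proof.
rewrite /sect => s; rewrite -hom_res1 s -hom_res0.
have [a [b abn]] := twist_witness n; symmetry; apply/(twistP _ _ abn).
by rewrite -!hom01Z (twistX _ abn).
Qed.


Lemma twist0r E n : twist n (0 : sec01 E) = 0. Proof. exact: raddf0. Qed.
Lemma twistB E n (u v : sec01 E) : twist n (u - v) = twist n u - twist n v.
Proof. exact: raddfB. Qed.
Lemma res00 E : res0 E 0 = 0. Proof. exact: raddf0. Qed.
Lemma res10 E : res1 E 0 = 0. Proof. exact: raddf0. Qed.
Lemma res0B E u v : res0 E (u - v) = res0 E u - res0 E v.
Proof. exact: raddfB. Qed.
Lemma res1B E u v : res1 E (u - v) = res1 E u - res1 E v.
Proof. exact: raddfB. Qed.

Lemma hom01_inj E F (f : coh_hom E F) : injective (hom0 f) -> injective (hom01 f).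
Proof.
move=> inj0 u v fuv; apply/eqP; rewrite -subr_eq0; apply/eqP; set z := u - v.
have fz : hom01 f z = 0 by rewrite hom01B fuv subrr.
have [n [y zy]] := res0_im z.
have /res0_ker[m fy] : res0 F (hom0 f y) = 0 by rewrite -hom_res0 -zy hom01Z fz scaler0.
apply: (@sec01_Xn_inj E (m + n)); rewrite scaler0 exprD -scalerA zy -res0Z.
by rewrite (inj0 ('X^m *: y) 0) ?res00 // hom0Z hom0_0.
Qed.

Lemma hom01_surj E F (f : coh_hom E F) :
  (forall w, exists v, hom0 f v = w) -> forall w, exists v, hom01 f v = w.
Proof.
move=> surj0 w; have [n [y wy]] := res0_im w; have [x xy] := surj0 y.
have [z zx] := sec01_Xn_surj n (res0 E x); exists z; apply: (@sec01_Xn_inj F n).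
by rewrite /= -hom01Z zx hom_res0 xy.
Qed.

Lemma hom01_zero E F (f : coh_hom E F) :
  (forall m, hom0 f m = 0) -> forall m, hom01 f m = 0.
Proof.
move=> f0 m; have [n [y my]] := res0_im m; apply: (@sec01_Xn_inj F n).
by rewrite /= -hom01Z my hom_res0 f0 res00 scaler0.
Qed.

Lemma is_zero_homP E F (f : coh_hom E F) :
  (forall m, hom0 f m = 0) -> (forall m, hom1 f m = 0) -> is_zero_hom f.
Proof. by move=> f0 f1; split=> //; apply: hom01_zero. Qed.

Lemma is_zero_objP E :
  (forall m : sec0 E, m = 0) -> (forall m : sec1 E, m = 0) -> is_zero_obj E.
Proof.
move=> z0 z1; split=> // m; have [n [y my]] := res0_im m.
by apply: (@sec01_Xn_inj E n); rewrite /= my (z0 y) res00 scaler0.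
Qed.

(** Localization at t is exact, so exactness over U0 already gives exactness over the overlap. *)
Lemma short_exactP X Z Y (f : coh_hom X Z) (g : coh_hom Z Y) :
  short_exact_seq 0 (hom0 f) (hom0 g) -> short_exact_seq 0 (hom1 f) (hom1 g) ->
  short_exact f g.
Proof.
move=> [i0 e0 s0] e1; split=> //; split; [exact: hom01_inj | | exact: hom01_surj].
move=> v; split=> [gv|[u <-]]; last first.
  have [n [y uy]] := res0_im u; apply: (@sec01_Xn_inj Y n).
  rewrite /= -!hom01Z uy !hom_res0 scaler0 (_ : hom0 g (hom0 f y) = 0) ?res00 //.
  by apply/e0; exists y.
have [n [y vy]] := res0_im v.
have /res0_ker[m gy] : res0 Y (hom0 g y) = 0 by rewrite -hom_res0 -vy hom01Z gv scaler0.
have /e0[x xy] : hom0 g ('X^m *: y) = 0 by rewrite hom0Z.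
have [u ux] := sec01_Xn_surj (m + n) (res0 X x); exists u.
apply: (@sec01_Xn_inj Z (m + n)); rewrite /= -hom01Z ux hom_res0 xy res0Z -vy.
by rewrite exprD scalerA.
Qed.

Definition id_hom E : coh_hom E E :=
  @CohHom k E E idfun idfun idfun (fun=> erefl) (fun=> erefl).

Section Composition.
Variables (E F G : coh k) (g : coh_hom F G) (f : coh_hom E F).

Fact comp_hom_res0 m : (hom01 g \o hom01 f) (res0 E m) = res0 G ((hom0 g \o hom0 f) m).
Proof. by rewrite /= !hom_res0. Qed.
Fact comp_hom_res1 m : (hom01 g \o hom01 f) (res1 E m) = res1 G ((hom1 g \o hom1 f) m).
Proof. by rewrite /= !hom_res1. Qed.

Definition comp_hom : coh_hom E G := @CohHom k E G (hom0 g \o hom0 f)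
  (hom1 g \o hom1 f) (hom01 g \o hom01 f) comp_hom_res0 comp_hom_res1.

End Composition.

Section Zero.
Variables E F : coh k.

Fact zero_hom_res0 m : (\0 : {linear sec01 E -> sec01 F}) (res0 E m) =
  res0 F ((\0 : {linear sec0 E -> sec0 F}) m).
Proof. by rewrite /= res00. Qed.
Fact zero_hom_res1 m : (\0 : {linear sec01 E -> sec01 F}) (res1 E m) =
  res1 F ((\0 : {linear sec1 E -> sec1 F}) m).
Proof. by rewrite /= res10. Qed.

Definition zero_hom : coh_hom E F := CohHom zero_hom_res0 zero_hom_res1.

End Zero.

Section Inverse.
Variables (M N : lmodType {poly k}) (f : {linear M -> N}).
Hypotheses (finj : injective f) (fsurj : forall w, exists v, f v = w).

(** Carrying the proof of injectivity as an argument lets the linear structure, which depends on it,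
    be attached to this term. *)
Definition lin_inv of injective f := fun w : N => projT1 (cid (fsurj w)) : M.

Lemma lin_invK : cancel (lin_inv finj) f.
Proof. by move=> w; rewrite /lin_inv; case: cid. Qed.

Lemma lin_inv_is_linear : linear (lin_inv finj).
Proof. by move=> p u v; apply: finj; rewrite linearP !lin_invK. Qed.
HB.instance Definition _ :=
  GRing.isLinear.Build {poly k} N M _ (lin_inv finj) lin_inv_is_linear.

End Inverse.

Lemma bij_hom_iso E F (f : coh_hom E F) :
  injective (hom0 f) -> injective (hom1 f) ->
  (forall w, exists v, hom0 f v = w) -> (forall w, exists v, hom1 f v = w) ->
  coh_iso E F.
Proof.
move=> i0 i1 s0 s1; have i01 := hom01_inj i0; have s01 := hom01_surj s0.
have g0 m : lin_inv s01 i01 (res0 F m) = res0 E (lin_inv s0 i0 m).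
  by apply: (i01); rewrite lin_invK hom_res0 lin_invK.
have g1 m : lin_inv s01 i01 (res1 F m) = res1 E (lin_inv s1 i1 m).
  by apply: (i01); rewrite lin_invK hom_res1 lin_invK.
exists f, (@CohHom k F E (lin_inv s0 i0) (lin_inv s1 i1) (lin_inv s01 i01) g0 g1).
by split; split=> m /=; rewrite ?lin_invK //; [apply: (i0)|apply: (i1)|apply: (i01)];
  rewrite lin_invK.
Qed.

End Sheaves.

(** * Noetherian modules *)


Section Noetherian.
Variable k : fieldType.

Lemma poly_ideal_principal (I : {poly k} -> Prop) :
  I 0 -> (forall p a b, I a -> I b -> I (p * a + b)) ->
  exists2 a, I a & forall b, I b -> a %| b.
Proof.
move=> I0 Ilin; pose P n := `[< exists a, [/\ I a, a != 0 & size a = n] >].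
have [[b Ib bn0]|none] := pselect (exists2 b, I b & b != 0); last first.
  exists 0 => // b Ib; rewrite dvd0p; apply: contra_notT none => bn0.
  by exists b.
have exP : exists n, P n by exists (size b); apply/asboolP; exists b.
case: (ex_minnP exP) => n /asboolP[a [Ia an0 sa]] amin; exists a => // c Ic.
apply/modp_eq0P/eqP/contraT => cn0; have := amin (size (c %% a)).
have -> : P (size (c %% a)).
  apply/asboolP; exists (c %% a); split=> //; rewrite [c %% a](_ : _ = - (c %/ a) * a + c).
    exact: Ilin.
  by rewrite [X in _ + X](divp_eq c a) mulNr addKr.
by move=> /(_ isT); rewrite -sa leqNgt ltn_modp an0.
Qed.

Definition submod (M : lmodType {poly k}) (N : M -> Prop) : Prop :=
  N 0 /\ forall p u v, N u -> N v -> N (p *: u + v).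

Definition span (M : lmodType {poly k}) n (g : 'I_n -> M) (m : M) : Prop :=
  exists c : 'I_n -> {poly k}, m = \sum_(i < n) c i *: g i.

Lemma submod_sum (M : lmodType {poly k}) (N : M -> Prop) n (c : 'I_n -> {poly k}) g :
  submod N -> (forall i, N (g i)) -> N (\sum_(i < n) c i *: g i).
Proof.
move=> [N0 Nlin] Ng; elim: n c g Ng => [|n IH] c g Ng; first by rewrite big_ord0.
by rewrite big_ord_recl; apply: Nlin => //; apply: IH.
Qed.

(** Induction on the number of generators: the coefficients along the first one form a principal
    ideal, and an element of N realizing its generator, together with generators of the part of N
    spanned by the remaining ones, spans N. *)
Lemma submod_span (M : lmodType {poly k}) n (g : 'I_n -> M) (N : M -> Prop) :
  submod N -> (forall m, N m -> span g m) ->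
  exists n' (g' : 'I_n' -> M), (forall i, N (g' i)) /\ forall m, N m -> span g' m.
Proof.
elim: n g N => [|n IH] g N [N0 Nlin] Ng.
  exists 0, g; split=> [[]|] //.
pose g1 i := g (lift ord0 i); pose N1 m := N m /\ span g1 m.
(* Coefficients are not unique when the generators satisfy relations, so [I] collects every possible
   first coefficient. *)
pose I a := exists2 m, N m & span g1 (m - a *: g ord0).
have span0 : span g1 0 by exists (fun=> 0); rewrite big1 // => i _; rewrite scale0r.
have span_lin p u v : span g1 u -> span g1 v -> span g1 (p *: u + v).
  move=> [c ->] [d ->]; exists (fun i => p * c i + d i).
  rewrite scaler_sumr -big_split; apply: eq_bigr => i _ /=.
  by rewrite scalerDl scalerA.
have [||a [m1 Nm1 sm1] amax] := @poly_ideal_principal I.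
- by exists 0; rewrite // scale0r subr0.
- move=> p a b [u Nu su] [v Nv sv]; exists (p *: u + v); first exact: Nlin.
  rewrite scalerDl -scalerA opprD addrACA -scalerBr; exact: span_lin.
have [|m []|n' [g' [N1g' spg']]] := IH g1 N1; [|by []|].
  by split; [split|move=> p u v [Nu su] [Nv sv]; split; [apply: Nlin|apply: span_lin]].
exists n'.+1, (fun i => if unlift ord0 i is Some j then g' j else m1); split=> [i|m Nm].
  by case: unlift => // j; case: (N1g' j).
have [c mc] := Ng m Nm; rewrite big_ord_recl in mc.
have /divpK ca : a %| c ord0.
  apply: amax; exists m => //; exists (fun i => c (lift ord0 i)).
  by rewrite mc addrC addKr.
have [|d md] := spg' (- (c ord0 %/ a) *: m1 + m).
  split; first exact: Nlin.
  have -> : - (c ord0 %/ a) *: m1 + m =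
      - (c ord0 %/ a) *: (m1 - a *: g ord0) + (m - c ord0 *: g ord0).
    by rewrite scalerBr scalerA mulNr ca !scaleNr opprK [m - _]addrC addrA addrK.
  apply: span_lin => //; exists (fun i => c (lift ord0 i)).
  by rewrite mc addrC addKr.
exists (fun i => if unlift ord0 i is Some j then d j else c ord0 %/ a).
rewrite big_ord_recl unlift_none; under eq_bigr do rewrite liftK.
by rewrite -md scaleNr addNKr.
Qed.

Lemma submod_fg (M : lmodType {poly k}) (N : M -> Prop) : fin_gen M -> submod N ->
  exists n (g : 'I_n -> M), (forall i, N (g i)) /\ forall m, N m -> span g m.
Proof. by move=> [n [g Mg]] Nsub; apply: (@submod_span _ n g) => // m _; apply: Mg. Qed.

Lemma submod_chain (M : lmodType {poly k}) (N : nat -> M -> Prop) : fin_gen M ->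
  (forall i, submod (N i)) -> (forall i m, N i m -> N i.+1 m) ->
  exists i, forall j m, N j m -> N i m.
Proof.
move=> Mfg Nsub Nmono; have mono i j m : (i <= j)%N -> N i m -> N j m.
  by move=> ij Nim; rewrite -(subnK ij); elim: (j - i)%N => //= d; apply: Nmono.
have [|n [g [Ug spg]]] := @submod_fg M (fun m => exists i, N i m) Mfg.
  split; first by exists 0; case: (Nsub 0).
  move=> p u v [i Niu] [j Njv]; exists (maxn i j); apply: (Nsub _).2.
    exact: mono (leq_maxl _ _) Niu.
  exact: mono (leq_maxr _ _) Njv.
have [h Nh] := choice Ug; exists (\max_i h i) => j m Njm.
have [|c ->] := spg m; first by exists j.
by apply: submod_sum => // i; apply: mono (Nh i); apply: leq_bigmax.
Qed.

End Noetherian.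

(** * Kernels and cokernels of sheaves *)


Section Induced.
Variable R : nzRingType.

Lemma coker_fin_gen (M N : lmodType R) (f : {linear M -> N}) :
  fin_gen N -> fin_gen (coker_mod f).
Proof.
move=> [n [g Ng]]; exists n, (fun i => coker_pi f (g i)) => w.
have [v <-] := coker_pi_surj w; have [c ->] := Ng v; exists c.
by rewrite raddf_sum; apply: eq_bigr => i _; apply: linearZ.
Qed.

Section KerMap.
Variables (M N M' N' : lmodType R) (f : {linear M -> N}) (f' : {linear M' -> N'}).
Variable h : {additive M -> M'}.
Hypothesis hker : forall m, f m = 0 -> f' (h m) = 0.

Fact ker_map_subproof (u : ker_mod f) : ker_pred f' (h (val u)).
Proof. by apply/eqP/hker; apply/eqP; case: u. Qed.

(** Here, and in [coker_map], [h] is only additive, so that the semilinear [res1] is covered along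
    with [res0]. *)
Definition ker_map (u : ker_mod f) : ker_mod f' := KerMod (ker_map_subproof u).

Fact ker_map_additive : zmod_morphism ker_map.
Proof. by move=> u v; apply: val_inj; rewrite /= !raddfB. Qed.

End KerMap.

Section CokerMap.
Variables (M N M' N' : lmodType R) (f : {linear M -> N}) (f' : {linear M' -> N'}).
Variable h : {additive N -> N'}.
Hypothesis him : forall m, exists m', f' m' = h (f m).

Definition coker_map (w : coker_mod f) : coker_mod f' := coker_pi f' (h (repr w)).

Lemma coker_mapE v : coker_map (coker_pi f v) = coker_pi f' (h v).
Proof.
have : coker_pi f (repr (coker_pi f v)) = coker_pi f v by rewrite /coker_pi reprK.
case/coker_piP=> m fm; apply/coker_piP; have [m' fm'] := him m.
by exists m'; rewrite fm' fm raddfB.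
Qed.

Fact coker_map_additive : zmod_morphism coker_map.
Proof.
move=> u v; have [x <-] := coker_pi_surj u; have [y <-] := coker_pi_surj v.
by rewrite -raddfB !coker_mapE !raddfB.
Qed.

End CokerMap.
End Induced.

Section KernelSheaf.
Variables (k : fieldType) (X Y : coh k) (f : coh_hom X Y).

Lemma ker_fin_gen (M N : lmodType {poly k}) (g : {linear M -> N}) :
  fin_gen M -> fin_gen (ker_mod g).
Proof.
move=> Mfg; have [|n [e [ke spe]]] := @submod_fg k M (fun m => g m = 0) Mfg.
  split; first exact: raddf0.
  by move=> p u v gu gv; rewrite linearP gu gv scaler0 addr0.
have ke' i : ker_pred g (e i) by apply/eqP.
exists n, (fun i => KerMod (ke' i)) => -[m gm].
have [|c mc] := spe m; first exact/eqP.
exists c; apply: val_inj; rewrite raddf_sum [LHS]mc; apply: eq_bigr => i _.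
by rewrite [RHS]linearZ.
Qed.

Fact ker_res0_ker m : hom0 f m = 0 -> hom01 f (res0 X m) = 0.
Proof. by rewrite hom_res0 => ->; rewrite res00. Qed.
Fact ker_res1_ker m : hom1 f m = 0 -> hom01 f (res1 X m) = 0.
Proof. by rewrite hom_res1 => ->; rewrite res10. Qed.

Definition kres0 := ker_map ker_res0_ker.
Definition kres1 := ker_map ker_res1_ker.
Fact kres0_linear : linear kres0.
Proof. by move=> p u v; apply: val_inj; rewrite /= res0D res0Z. Qed.
HB.instance Definition _ := GRing.isLinear.Build {poly k}
  (ker_mod (hom0 f)) (ker_mod (hom01 f)) _ kres0 kres0_linear.
HB.instance Definition _ := GRing.isZmodMorphism.Build
  (ker_mod (hom1 f)) (ker_mod (hom01 f)) kres1 (ker_map_additive _).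

Fact kres1C (c : k) (m : ker_mod (hom1 f)) : kres1 (c%:P *: m) = c%:P *: kres1 m.
Proof. by apply: val_inj; rewrite /= res1C. Qed.
Fact kres1X (m : ker_mod (hom1 f)) : 'X *: kres1 ('X *: m) = kres1 m.
Proof. by apply: val_inj; rewrite /= res1X. Qed.

Fact ksec01_inv (m : ker_mod (hom01 f)) : ker_pred (hom01 f) (twist (-1) (val m)).
Proof.
apply/eqP; apply: (@sec01_Xn_inj _ Y 1); rewrite /= -hom01Z scaler0 twistV1X.
by apply/eqP; case: m.
Qed.

Fact ksec01_bij : bijective (fun m : ker_mod (hom01 f) => 'X *: m).
Proof.
exists (fun m => KerMod (ksec01_inv m)) => m; apply: val_inj; rewrite /=.
  exact: twist1V.
exact: twistV1X.
Qed.

Fact kres0_ker (m : ker_mod (hom0 f)) : kres0 m = 0 -> exists n, 'X^n *: m = 0.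
Proof.
move=> /(congr1 val)/= /res0_ker[n e]; exists n; exact: val_inj.
Qed.
Fact kres1_ker (m : ker_mod (hom1 f)) : kres1 m = 0 -> exists n, 'X^n *: m = 0.
Proof.
move=> /(congr1 val)/= /res1_ker[n e]; exists n; exact: val_inj.
Qed.

Fact kres0_im (z : ker_mod (hom01 f)) : exists n (m : ker_mod (hom0 f)), 'X^n *: z = kres0 m.
Proof.
have [n [y e]] := res0_im (val z); have fz : hom01 f (val z) = 0 by apply/eqP; case: z {e}.
(* The image of [y] vanishes only on the overlap; over U0 a further power of t is needed to enter
   the kernel. *)
have /res0_ker[m fy] : res0 Y (hom0 f y) = 0 by rewrite -hom_res0 -e hom01Z fz scaler0.
have ky : ker_pred (hom0 f) ('X^m *: y) by apply/eqP; rewrite hom0Z.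
exists (m + n)%N, (KerMod ky); apply: val_inj.
by rewrite /= res0Z -e exprD scalerA.
Qed.

Fact kres1_im (z : ker_mod (hom01 f)) : exists n (m : ker_mod (hom1 f)), z = 'X^n *: kres1 m.
Proof.
have [n [y e]] := res1_im (val z); have fz : hom01 f (val z) = 0 by apply/eqP; case: z {e}.
have /res1_ker[m fy] : res1 Y (hom1 f y) = 0.
  by rewrite -hom_res1; apply: (@sec01_Xn_inj _ Y n); rewrite /= -hom01Z -e fz scaler0.
have ky : ker_pred (hom1 f) ('X^m *: y) by apply/eqP; rewrite hom1Z.
exists (n + m)%N, (KerMod ky); apply: val_inj.
by rewrite /= exprD -scalerA res1_Xn.
Qed.

Definition ker_coh : coh k :=
  @Coh k (ker_mod (hom0 f)) (ker_mod (hom1 f)) (ker_mod (hom01 f)) kres0 kres1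
    kres1C kres1X ksec01_bij kres0_ker kres0_im kres1_ker kres1_im
    (ker_fin_gen _ (sec0_fg X)) (ker_fin_gen _ (sec1_fg X)).

Definition ker_incl : coh_hom ker_coh X :=
  @CohHom k ker_coh X \val \val \val (fun=> erefl) (fun=> erefl).

Lemma ker_exact : 
  (forall w, exists v, hom0 f v = w) -> (forall w, exists v, hom1 f v = w) ->
  short_exact ker_incl f.
Proof.
move=> s0 s1; apply: short_exactP; split=> //; try exact: val_inj.
  move=> v; split=> [fv|[[u fu] <-]]; last exact/eqP.
  by have kv : ker_pred (hom0 f) v by [apply/eqP]; exists (KerMod kv).
move=> v; split=> [fv|[[u fu] <-]]; last exact/eqP.
by have kv : ker_pred (hom1 f) v by [apply/eqP]; exists (KerMod kv).
Qed.

End KernelSheaf.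

Section CokernelSheaf.
Variables (k : fieldType) (X Z : coh k) (f : coh_hom X Z).

Fact coker_res0_im m : exists m', hom01 f m' = res0 Z (hom0 f m).
Proof. by exists (res0 X m); rewrite hom_res0. Qed.
Fact coker_res1_im m : exists m', hom01 f m' = res1 Z (hom1 f m).
Proof. by exists (res1 X m); rewrite hom_res1. Qed.

Let Q0 : lmodType {poly k} := coker_mod (hom0 f).
Let Q1 : lmodType {poly k} := coker_mod (hom1 f).
Let Q01 : lmodType {poly k} := coker_mod (hom01 f).

Definition cres0 : Q0 -> Q01 := @coker_map _ _ _ _ _ (hom0 f) (hom01 f) (res0 Z).
Definition cres1 : Q1 -> Q01 := @coker_map _ _ _ _ _ (hom1 f) (hom01 f) (res1 Z).

Lemma cres0E v : cres0 (coker_pi _ v) = coker_pi _ (res0 Z v).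
Proof. exact: coker_mapE coker_res0_im _. Qed.
Lemma cres1E v : cres1 (coker_pi _ v) = coker_pi _ (res1 Z v).
Proof. exact: coker_mapE coker_res1_im _. Qed.

Let piZ (M N : lmodType {poly k}) (g : {linear M -> N}) (p : {poly k}) v :
  p *: coker_pi g v = coker_pi g (p *: v).
Proof. by rewrite linear_scale. Qed.
Let piD (M N : lmodType {poly k}) (g : {linear M -> N}) u v :
  coker_pi g (u + v) = coker_pi g u + coker_pi g v :> coker_mod g.
Proof. exact: raddfD. Qed.

Fact cres0_linear : linear cres0.
Proof.
move=> p u v; have [x <-] := coker_pi_surj u; have [y <-] := coker_pi_surj v.
by rewrite (piZ (hom0 f)) -piD !cres0E piZ -piD res0D res0Z.
Qed.
HB.instance Definition _ := GRing.isLinear.Build {poly k} Q0 Q01 _ cres0 cres0_linear.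
HB.instance Definition _ := GRing.isZmodMorphism.Build Q1 Q01 cres1
  (coker_map_additive coker_res1_im).

Fact cres1C (c : k) (m : Q1) : cres1 (c%:P *: m) = c%:P *: cres1 m.
Proof. by have [x <-] := coker_pi_surj m; rewrite (piZ (hom1 f)) !cres1E res1C piZ. Qed.
Fact cres1X (m : Q1) : 'X *: cres1 ('X *: m) = cres1 m.
Proof. by have [x <-] := coker_pi_surj m; rewrite (piZ (hom1 f)) !cres1E piZ res1X. Qed.

Fact csec01_bij : bijective (fun m : Q01 => 'X *: m).
Proof.
(* Division by t preserves the image of f, so it descends to the cokernel. *)
have inv m : exists m', hom01 f m' = twist (-1) (hom01 f m).
  exists (twist (-1) m); apply: (@sec01_Xn_inj _ Z 1) => /=.
  by rewrite -hom01Z !twistV1X.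
exists (@coker_map _ _ _ _ _ (hom01 f) (hom01 f) (twist (-1))) => m;
  have [x <-] := coker_pi_surj m.
  rewrite (piZ (hom01 f)) (coker_mapE inv); congr (coker_pi _ _); exact: twist1V.
rewrite (coker_mapE inv) (piZ (hom01 f)); congr (coker_pi _ _); exact: twistV1X.
Qed.

Fact cres0_ker (m : Q0) : cres0 m = 0 -> exists n, 'X^n *: m = 0.
Proof.
have [x <-] := coker_pi_surj m; rewrite cres0E => /coker_pi0[z zx].
have [n [y zy]] := res0_im z.
have /res0_ker[l e] : res0 Z (hom0 f y - 'X^n *: x) = 0.
  by rewrite res0B res0Z -hom_res0 -zy hom01Z zx subrr.
exists (l + n)%N; rewrite (piZ _ _ x); apply/coker_pi0; exists ('X^l *: y).
by apply/eqP; rewrite hom0Z exprD -scalerA -subr_eq0 -scalerBr e.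
Qed.
Fact cres1_ker (m : Q1) : cres1 m = 0 -> exists n, 'X^n *: m = 0.
Proof.
have [x <-] := coker_pi_surj m; rewrite cres1E => /coker_pi0[z zx].
have [n [y zy]] := res1_im z.
have /res1_ker[l e] : res1 Z (hom1 f y - 'X^n *: x) = 0.
  rewrite res1B -hom_res1; apply: (@sec01_Xn_inj _ Z n); rewrite /= scaler0 scalerBr.
  by rewrite -hom01Z -zy res1_Xn zx subrr.
exists (l + n)%N; rewrite (piZ _ _ x); apply/coker_pi0; exists ('X^l *: y).
by apply/eqP; rewrite hom1Z exprD -scalerA -subr_eq0 -scalerBr e.
Qed.

Fact cres0_im (z : Q01) : exists n (m : Q0), 'X^n *: z = cres0 m.
Proof.
have [x <-] := coker_pi_surj z; have [n [y e]] := res0_im x.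
by exists n, (coker_pi _ y); rewrite cres0E piZ e.
Qed.
Fact cres1_im (z : Q01) : exists n (m : Q1), z = 'X^n *: cres1 m.
Proof.
have [x <-] := coker_pi_surj z; have [n [y e]] := res1_im x.
by exists n, (coker_pi _ y); rewrite cres1E piZ -e.
Qed.

Definition coker_coh : coh k :=
  @Coh k Q0 Q1 Q01 cres0 cres1 cres1C cres1X csec01_bij cres0_ker cres0_im
    cres1_ker cres1_im (coker_fin_gen _ (sec0_fg Z)) (coker_fin_gen _ (sec1_fg Z)).

Definition coker_proj : coh_hom Z coker_coh :=
  @CohHom k Z coker_coh (coker_pi (hom0 f)) (coker_pi (hom1 f)) (coker_pi (hom01 f))
    (fun m => esym (cres0E m)) (fun m => esym (cres1E m)).

Lemma coker_exact : injective (hom0 f) -> injective (hom1 f) -> short_exact f coker_proj.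
Proof.
move=> i0 i1; apply: short_exactP; split=> //; try exact: coker_pi_surj;
  exact: coker_pi0.
Qed.

End CokernelSheaf.

(** * Orthogonal classes and Noetherian induction *)


Section Factor.
Variable R : pzRingType.
Implicit Types M N P : lmodType R.

Lemma linear_factor_epi M N P (g : {linear M -> N}) (h : {linear M -> P}) :
  (forall w, exists v, g v = w) -> (forall m, g m = 0 -> h m = 0) ->
  exists h' : {linear N -> P}, forall m, h' (g m) = h m.
Proof.
move=> gsurj gh; have [s sK] := choice gsurj.
have hE m m' : g m = g m' -> h m = h m'.
  move=> e; apply/eqP; rewrite -subr_eq0 -linearB gh ?eqxx //.
  by rewrite linearB e subrr.
have lin : linear (h \o s).
  by move=> p u v; rewrite /= -linearP; apply: hE; rewrite linearP !sK.
pose h' : {linear N -> P} := HB.pack (h \o s) (GRing.isLinear.Build R N P _ (h \o s) lin).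
by exists h' => m; apply: hE; rewrite sK.
Qed.

Lemma linear_factor_mono M N P (f : {linear M -> N}) (h : {linear P -> N}) :
  injective f -> (forall p, exists m, f m = h p) ->
  exists h' : {linear P -> M}, forall p, f (h' p) = h p.
Proof.
move=> finj fh; have [s sK] := choice fh.
have lin : linear s.
  by move=> p u v; apply: finj; rewrite linearP !sK linearP.
pose h' : {linear P -> M} := HB.pack s (GRing.isLinear.Build R P M _ s lin).
by exists h'.
Qed.

End Factor.

Section Category.
Variable k : fieldType.
Implicit Types (E F W X Y Z : coh k) (C D S : coh k -> Prop).

(** The two charts suffice: injectivity over the overlap follows by [hom01_inj], and surjectivity by
    [hom01_surj]. *)
Definition mono_hom E F (f : coh_hom E F) : Prop := injective (hom0 f) /\ injective (hom1 f).

Definition epi_hom E F (f : coh_hom E F) : Prop :=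
  (forall w, exists v, hom0 f v = w) /\ (forall w, exists v, hom1 f v = w).

Lemma mono_homP E F (f : coh_hom E F) :
  (forall v, hom0 f v = 0 -> v = 0) -> (forall v, hom1 f v = 0 -> v = 0) -> mono_hom f.
Proof.
move=> i0 i1; split=> u v fuv; apply/eqP; rewrite -subr_eq0; apply/eqP.
  by apply: i0; rewrite hom0B fuv subrr.
by apply: i1; rewrite hom1B fuv subrr.
Qed.

Lemma hom01_twist E F (f : coh_hom E F) n z : hom01 f (twist n z) = twist n (hom01 f z).
Proof.
have [a [b abn]] := twist_witness n; symmetry; apply/(twistP _ _ abn).
by rewrite -!hom01Z (twistX _ abn).
Qed.

Lemma short_exact_comp0 X Z Y (f : coh_hom X Z) (g : coh_hom Z Y) :
  short_exact f g -> is_zero_hom (comp_hom g f).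
Proof.
move=> [[_ e0 _] [_ e1 _] [_ e01 _]].
by split=> m; [apply/e0|apply/e1|apply/e01]; exists m.
Qed.

Lemma short_exact_mono X Z Y (f : coh_hom X Z) (g : coh_hom Z Y) :
  short_exact f g -> mono_hom f.
Proof. by move=> [[i0 _ _] [i1 _ _] _]. Qed.

Lemma short_exact_epi X Z Y (f : coh_hom X Z) (g : coh_hom Z Y) :
  short_exact f g -> epi_hom g.
Proof. by move=> [[_ _ s0] [_ _ s1] _]. Qed.

Lemma factor_cokernel X Z Y W (f : coh_hom X Z) (g : coh_hom Z Y) (h : coh_hom Z W) :
  short_exact f g -> is_zero_hom (comp_hom h f) ->
  exists h' : coh_hom Y W,
    (forall m, hom0 h' (hom0 g m) = hom0 h m) /\ (forall m, hom1 h' (hom1 g m) = hom1 h m).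
Proof.
move=> [[_ e0 s0] [_ e1 s1] [_ e01 _]] [z0 z1 z01].
have [h0 h0E] : exists h' : {linear sec0 Y -> sec0 W}, forall m, h' (hom0 g m) = hom0 h m.
  by apply: linear_factor_epi => // m /e0[u <-]; apply: z0.
have [h1 h1E] : exists h' : {linear sec1 Y -> sec1 W}, forall m, h' (hom1 g m) = hom1 h m.
  by apply: linear_factor_epi => // m /e1[u <-]; apply: z1.
have compat n y0 y1 : sect n y0 y1 -> sect n (h0 y0) (h1 y1).
  have [m0 <-] := s0 y0; have [m1 <-] := s1 y1; rewrite /sect h0E h1E => s.
  (* The lifts [m0] and [m1] need not match, but their mismatch lies in the image of f, which h
     kills. *)
  have /e01[u ud] : hom01 g (res1 Z m1 - twist n (res0 Z m0)) = 0.
    by rewrite hom01B hom01_twist hom_res1 hom_res0 s subrr.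
  apply/eqP; rewrite -subr_eq0 -hom_res1 -hom_res0 -hom01_twist -hom01B -ud.
  by apply/eqP; apply: z01.
by exists (glue_hom compat).
Qed.

Lemma factor_kernel X Z Y W (f : coh_hom X Z) (g : coh_hom Z Y) (h : coh_hom W Z) :
  short_exact f g -> is_zero_hom (comp_hom g h) ->
  exists h' : coh_hom W X,
    (forall m, hom0 f (hom0 h' m) = hom0 h m) /\ (forall m, hom1 f (hom1 h' m) = hom1 h m).
Proof.
move=> [[i0 e0 _] [i1 e1 _] [i01 _ _]] [z0 z1 _].
have [h0 h0E] : exists h' : {linear sec0 W -> sec0 X}, forall m, hom0 f (h' m) = hom0 h m.
  by apply: linear_factor_mono => // m; apply/e0; apply: z0.
have [h1 h1E] : exists h' : {linear sec1 W -> sec1 X}, forall m, hom1 f (h' m) = hom1 h m.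
  by apply: linear_factor_mono => // m; apply/e1; apply: z1.
have compat n y0 y1 : sect n y0 y1 -> sect n (h0 y0) (h1 y1).
  move=> /(hom_sect h) s; apply: i01.
  by rewrite hom_res1 hom01_twist hom_res0 h0E h1E.
by exists (glue_hom compat).
Qed.

(** The classes of a torsion pair are orthogonal to each other in this sense and determined by it,
    so they inherit the closure properties proved for orthogonals. *)
Definition lperp C X : Prop := forall Y, C Y -> forall f : coh_hom X Y, is_zero_hom f.
Definition rperp C Y : Prop := forall X, C X -> forall f : coh_hom X Y, is_zero_hom f.

Lemma lperp_ext C : ext_closed (lperp C).
Proof.
move=> X Z Y f g e Xp Yp W CW h; have [h' [h0 h1]] := factor_cokernel e (Xp W CW (comp_hom h f)).
have [z0 z1 _] := Yp W CW h'.
by apply: is_zero_homP => m; rewrite -?h0 -?h1 ?z0 ?z1.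
Qed.

Lemma rperp_ext C : ext_closed (rperp C).
Proof.
move=> X Z Y f g e Xp Yp W CW h; have [h' [h0 h1]] := factor_kernel e (Yp W CW (comp_hom g h)).
have [z0 z1 _] := Xp W CW h'.
by apply: is_zero_homP => m; rewrite -?h0 -?h1 ?z0 ?z1 ?hom0_0 ?hom1_0.
Qed.

Lemma lperp_epi C X Y (g : coh_hom X Y) : epi_hom g -> lperp C X -> lperp C Y.
Proof.
move=> [s0 s1] Xp W CW h; have [z0 z1 _] := Xp W CW (comp_hom h g).
by apply: is_zero_homP => m; [have [v <-] := s0 m; exact: z0|have [v <-] := s1 m; exact: z1].
Qed.

Lemma rperp_mono C X Y (f : coh_hom X Y) : mono_hom f -> rperp C Y -> rperp C X.
Proof.
move=> [i0 i1] Yp W CW h; have [z0 z1 _] := Yp W CW (comp_hom f h).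
apply: is_zero_homP => m; [apply: (i0)|apply: (i1)].
  by rewrite hom0_0; apply: z0.
by rewrite hom1_0; apply: z1.
Qed.

Lemma iso_epi X Y : coh_iso X Y -> exists f : coh_hom X Y, epi_hom f.
Proof.
move=> [f [g [_ [fK0 fK1 _]]]]; exists f.
by split=> w; [exists (hom0 g w)|exists (hom1 g w)].
Qed.

Lemma iso_mono X Y : coh_iso X Y -> exists f : coh_hom Y X, mono_hom f.
Proof.
move=> [f [g [_ [fK0 fK1 _]]]]; exists g.
by split; [apply: can_inj fK0|apply: can_inj fK1].
Qed.

Lemma coh_iso_sym X Y : coh_iso X Y -> coh_iso Y X.
Proof. by move=> [f [g [gf fg]]]; exists g, f. Qed.

Lemma summand_epi X Z : direct_summand X Z -> exists f : coh_hom Z X, epi_hom f.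
Proof.
move=> [Y [i [j [p [q [[K0 K1 _] _ _]]]]]]; exists p.
by split=> w; [exists (hom0 i w)|exists (hom1 i w)].
Qed.

Lemma summand_mono X Z : direct_summand X Z -> exists f : coh_hom X Z, mono_hom f.
Proof.
move=> [Y [i [j [p [q [[K0 K1 _] _ _]]]]]]; exists i.
by split; [apply: can_inj K0|apply: can_inj K1].
Qed.

Lemma lperp_iso C : iso_closed (lperp C).
Proof. by move=> X Y /iso_epi[f] /lperp_epi; apply. Qed.
Lemma rperp_iso C : iso_closed (rperp C).
Proof. by move=> X Y /iso_mono[f] /rperp_mono; apply. Qed.

Lemma lperp_summand C : summand_closed (lperp C).
Proof. by move=> X Z /summand_epi[f] /lperp_epi; apply. Qed.
Lemma rperp_summand C : summand_closed (rperp C).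
Proof. by move=> X Z /summand_mono[f] /rperp_mono; apply. Qed.

Lemma zero_obj_summand E X : is_zero_obj E -> direct_summand E X.
Proof.
move=> [z0 z1 z01]; exists X, (zero_hom E X), (id_hom X), (zero_hom X E), (id_hom X).
split; [split=> m|split=> m|split=> m] => //=; by rewrite ?add0r.
Qed.

Lemma zero_hom_mono_zero X Y (f : coh_hom X Y) :
  mono_hom f -> is_zero_hom f -> is_zero_obj X.
Proof.
move=> [i0 i1] [z0 z1 _]; apply: is_zero_objP => m.
  by apply: (i0); rewrite hom0_0.
by apply: (i1); rewrite hom1_0.
Qed.

Lemma hom_to_zero X Y (f : coh_hom X Y) : is_zero_obj Y -> is_zero_hom f.
Proof.
move=> [z0 z1 z01].
by split=> m; rewrite ?(z0 (hom0 _ _)) ?(z1 (hom1 _ _)) ?(z01 (hom01 _ _)).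
Qed.

Lemma hom_from_zero X Y (f : coh_hom X Y) : is_zero_obj X -> is_zero_hom f.
Proof.
move=> [z0 z1 z01]; split=> m.
- by rewrite (z0 m) hom0_0.
- by rewrite (z1 m) hom1_0.
- by rewrite (z01 m) hom01_0.
Qed.

Lemma short_exact_zero_right X Z Y (f : coh_hom X Z) (g : coh_hom Z Y) :
  short_exact f g -> is_zero_hom g -> coh_iso X Z.
Proof.
move=> [[i0 e0 _] [i1 e1 _] _] [z0 z1 _].
by apply: (@bij_hom_iso _ _ _ f) => // w; [apply/e0|apply/e1].
Qed.

Lemma short_exact_zero_left X Z Y (f : coh_hom X Z) (g : coh_hom Z Y) :
  short_exact f g -> is_zero_hom f -> coh_iso Z Y.
Proof.
move=> [[_ e0 s0] [_ e1 s1] _] [z0 z1 _]; have [i0 i1] : mono_hom g.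
  by apply: mono_homP => v; [move=> /e0[u <-]|move=> /e1[u <-]].
exact: (@bij_hom_iso _ _ _ g).
Qed.

Lemma generated_iso S : iso_closed (generated S).
Proof. by move=> X Y XY gX C Ci Ce Cs CS; apply: (Ci _ _ XY); apply: gX. Qed.
Lemma generated_ext S : ext_closed (generated S).
Proof.
by move=> X Z Y f g e gX gY C Ci Ce Cs CS; apply: (Ce _ _ _ _ _ e); [apply: gX|apply: gY].
Qed.
Lemma generated_summand S : summand_closed (generated S).
Proof. by move=> X Z XZ gZ C Ci Ce Cs CS; apply: (Cs _ _ XZ); apply: gZ. Qed.
Lemma generated_mem S X : S X -> generated S X.
Proof. by move=> SX C _ _ _; apply. Qed.
(** Zero objects enter through closure under summands, as X is the direct sum of E and X. *)
Lemma generated_zero S X E : S X -> is_zero_obj E -> generated S E.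
Proof.
move=> SX E0; apply: (generated_summand (zero_obj_summand X E0)).
exact: generated_mem.
Qed.

(* Noetherian induction: an infinite chain of proper quotients of [Z] would
   give an infinite strictly increasing chain of kernels in [Z]. *)
Lemma quotient_ind (Q : coh k -> Prop) :
  (forall Z, (forall Z' (g : coh_hom Z Z'), epi_hom g -> ~ mono_hom g -> Q Z') -> Q Z) ->
  forall Z, Q Z.
Proof.
move=> Qind Z; apply: contrapT => nQZ.
pose T := {Z' : coh k & {g : coh_hom Z Z' | epi_hom g /\ ~ Q Z'}}.
(* A quotient of [Z] violating [Q] has a proper quotient violating [Q]; the informative form allows
   this to be iterated. *)
have step (a : T) : {b : T | exists h : coh_hom (projT1 a) (projT1 b),
    [/\ ~ mono_hom h,
      forall m, hom0 (sval (projT2 b)) m = hom0 h (hom0 (sval (projT2 a)) m) &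
      forall m, hom1 (sval (projT2 b)) m = hom1 h (hom1 (sval (projT2 a)) m)]}.
  case: a => Z' [g [[s0 s1] nQ]] /=; apply: cid; apply: contrapT => none.
  apply: nQ; apply: Qind => Z'' h [t0 t1] nmono; apply: contrapT => nQ''.
  have ge : epi_hom (comp_hom h g) /\ ~ Q Z''.
    split=> //; split=> w; [have [v <-] := t0 w|have [v <-] := t1 w].
      by have [u <-] := s0 v; exists u.
    by have [u <-] := s1 v; exists u.
  by apply: none; exists (existT _ Z'' (exist _ (comp_hom h g) ge)), h.
have idP : epi_hom (id_hom Z) /\ ~ Q Z by split=> //; split=> w; exists w.
pose a0 : T := existT _ Z (exist _ (id_hom Z) idP).
pose a n : T := iter n (fun x => sval (step x)) a0.
pose N0 n m := hom0 (sval (projT2 (a n))) m = 0.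
pose N1 n m := hom1 (sval (projT2 (a n))) m = 0.
have stepP n : exists h : coh_hom (projT1 (a n)) (projT1 (a n.+1)),
    [/\ ~ mono_hom h,
      forall m, hom0 (sval (projT2 (a n.+1))) m = hom0 h (hom0 (sval (projT2 (a n))) m) &
      forall m, hom1 (sval (projT2 (a n.+1))) m = hom1 h (hom1 (sval (projT2 (a n))) m)].
  exact: (svalP (step (a n))).
have [||i Ni] := submod_chain (N := N0) (sec0_fg Z).
- move=> i; split; first exact: hom0_0.
  by rewrite /N0 => p u v u0 v0; rewrite linearP u0 v0 scaler0 addr0.
- by move=> i m; rewrite /N0; have [h [_ -> _]] := stepP i => ->; rewrite hom0_0.
have [||j Nj] := submod_chain (N := N1) (sec1_fg Z).
- move=> l; split; first exact: hom1_0.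
  by rewrite /N1 => p u v u0 v0; rewrite linearP u0 v0 scaler0 addr0.
- by move=> l m; rewrite /N1; have [h [_ _ ->]] := stepP l => ->; rewrite hom1_0.
(* From index [l] on both chains of kernels are stationary, so the map out of the l-th quotient is
   injective, against the choice of the sequence. *)
pose l := maxn i j.
have mono0 d m : N0 i m -> N0 (i + d)%N m.
  elim: d => [|d IH]; first by rewrite addn0.
  by rewrite addnS => /IH; rewrite /N0; have [h [_ -> _]] := stepP (i + d)%N => ->; rewrite hom0_0.
have mono1 d m : N1 j m -> N1 (j + d)%N m.
  elim: d => [|d IH]; first by rewrite addn0.
  by rewrite addnS => /IH; rewrite /N1; have [h [_ _ ->]] := stepP (j + d)%N => ->; rewrite hom1_0.
have [h [nmono h0 h1]] := stepP l; apply: nmono.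
have [s0 s1] := (svalP (projT2 (a l))).1; apply: mono_homP => v.
  have [u <-] := s0 v; rewrite -h0 => /Ni /(mono0 (l - i)%N).
  by rewrite subnKC ?leq_maxl.
have [u <-] := s1 v; rewrite -h1 => /Nj /(mono1 (l - j)%N).
by rewrite subnKC ?leq_maxr.
Qed.

End Category.

(** * Skyscraper sheaves *)


Section Skyscrapers.
Variable k : fieldType.
Implicit Types (E : coh k) (x y : P1 k).

(* [E] has a subsheaf isomorphic to [skyscraper x] *)
Definition eigen E x : Prop :=
  match x with
  | Some a => exists2 w : sec0 E, w <> 0 & 'X *: w = a%:P *: w
  | None => exists2 w : sec1 E, w <> 0 & 'X *: w = 0
  end.

Lemma scale_eigen (M : lmodType {poly k}) (a : k) (w : M) (p : {poly k}) :
  'X *: w = a%:P *: w -> p *: w = (p.[a])%:P *: w.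
Proof.
move=> Xw; have /factor_theorem[q pq] : root (p - (p.[a])%:P) a.
  by rewrite rootE !hornerE subrr.
apply/eqP; rewrite -subr_eq0 -scalerBl pq -scalerA scalerBl Xw subrr scaler0 //.
Qed.

Lemma scaleC_eq0 (M : lmodType {poly k}) (c : k) (w : M) : c%:P *: w = 0 -> c = 0 \/ w = 0.
Proof.
have [-> _|c0 e] := eqVneq c 0; [by left|right].
by rewrite -[w]scale1r -[1]/(1%:P) -(mulVf c0) polyCM -scalerA e scaler0.
Qed.

Lemma eigen_sections E x : eigen E x ->
  exists (w0 : sec0 E) (w1 : sec1 E),
    [/\ 'X *: w0 = (t_at x)%:P *: w0, 'X *: w1 = (s_at x)%:P *: w1,
        res0 E w0 = res1 E w1,
        (if in0 x then w0 <> 0 else w0 = 0) & (if in1 x then w1 <> 0 else w1 = 0)].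
Proof.
case: x => [a|] [w wn0 Xw]; last first.
  exists 0, w; rewrite /s_at /= invr0 polyC0 !scale0r scaler0 Xw res00.
  by split=> //; rewrite -[RHS]res1X Xw res10 scaler0.
rewrite /s_at /in0 /in1 /=.
have [a0|a0] := eqVneq a 0.
  rewrite a0 in Xw *; exists w, 0; rewrite eqxx Xw !scaler0 res10.
  split=> //; apply: (@sec01_Xn_inj _ E 1).
  by rewrite /= -res0Z Xw polyC0 scale0r res00 scaler0.
have zX n : 'X^n *: res0 E w = (a ^+ n)%:P *: res0 E w.
  by rewrite -!res0Z (scale_eigen 'X^n Xw) hornerXn.
(* The section over U1 is found by transport through the overlap: there t acts on [w] as a, so t^n
   can be replaced by the constant a^n. *)
have [n [m wm]] := res1_im (res0 E w).
have rm : res1 E ((a ^+ n)%:P *: m) = res0 E w.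
  by rewrite res1C; apply: (@sec01_Xn_inj _ E n); rewrite /= scaleCA -wm zX.
set m1 := _ *: m in rm.
have /res1_ker[l e] : res1 E ('X *: m1 - (a^-1)%:P *: m1) = 0.
  rewrite res1B res1C; apply: (@sec01_Xn_inj _ E 1); rewrite /= scaler0 scalerBr.
  rewrite res1X rm scaleCA -[X in _%:P *: (X *: _)]expr1 zX expr1 scalerA -polyCM.
  by rewrite mulVf // scale1r subrr.
(* The section [m1] is an eigenvector only up to an element killed by s^l. Multiplying by a^l s^l
   removes this defect and acts as 1 on the overlap. *)
have rl : res1 E ((a ^+ l)%:P *: ('X^l *: m1)) = res0 E w.
  rewrite res1C; apply: (@sec01_Xn_inj _ E l); rewrite /= scaleCA res1_Xn rm.
  by rewrite zX.
exists w, ((a ^+ l)%:P *: ('X^l *: m1)); split=> //.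
  rewrite scaleCA [RHS]scaleCA; congr (_ *: _); apply/eqP.
  by rewrite -subr_eq0 scaleCA [X in _ - X]scaleCA -scalerBr e.
case: eqVneq => [[]|_ w10]; first by move/eqP; rewrite (negbTE a0).
apply: wn0; have /res0_ker[j] : res0 E w = 0 by rewrite -rl w10 res10.
rewrite (scale_eigen 'X^j Xw) hornerXn => /scaleC_eq0[|//] /eqP.
by rewrite expf_eq0 (negbTE a0) andbF.
Qed.

Lemma sum_rV_bool (b : bool) (v : 'rV[k]_b) : \sum_i v 0 i = 0 -> v = 0.
Proof.
case: b v => v; last by move=> _; apply/rowP => -[].
by rewrite big_ord1 => v0; apply/rowP => i; rewrite ord1 v0 mxE.
Qed.

Section EvalHom.
Variables (a : k) (b : bool) (M : lmodType {poly k}) (w : M).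
Hypothesis Xw : 'X *: w = a%:P *: w.

(** The sum reads off the single coordinate when [b] is true and is 0 when [b] is false, which
    treats both cases at once. *)
Definition eval_hom of 'X *: w = a%:P *: w :=
  fun v : eval_module a b => (\sum_i (v : 'rV[k]_b) 0 i)%:P *: w.

Lemma eval_hom_is_linear : linear (eval_hom Xw).
Proof.
move=> p u v; rewrite /eval_hom scalerA mulrC -scalerA (scale_eigen p Xw) scalerA -polyCM.
rewrite -scalerDl -polyCD; congr (_%:P *: _); rewrite mulr_suml -big_split.
by apply: eq_bigr => i _; rewrite !mxE mulrC.
Qed.
HB.instance Definition _ :=
  GRing.isLinear.Build {poly k} (eval_module a b) M _ (eval_hom Xw) eval_hom_is_linear.

Lemma eval_hom_eq0 (v : eval_module a b) : (b -> w <> 0) -> eval_hom Xw v = 0 -> v = 0.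
Proof.
move=> bw /scaleC_eq0[/sum_rV_bool//|].
by case: b bw v => bw v; [move/(bw isT)|move=> _; apply/rowP => -[]].
Qed.

End EvalHom.

Lemma sum_restr (b c : bool) (v : 'rV[k]_b) : c -> \sum_i restr c v 0 i = \sum_i v 0 i.
Proof.
case: c => // _; rewrite big_ord1 mxE; apply: eq_bigr => i _.
by rewrite mxE mulr1.
Qed.

Lemma eigen_sky_hom E x : eigen E x -> exists f : coh_hom (skyscraper x) E, mono_hom f.
Proof.
move=> /eigen_sections[w0 [w1 [Xw0 Xw1 w01 n0 n1]]].
pose f0 : {linear sec0 (skyscraper x) -> sec0 E} := eval_hom (b := in0 x) Xw0.
pose f1 : {linear sec1 (skyscraper x) -> sec1 E} := eval_hom (b := in1 x) Xw1.
have compat n (y0 : sec0 (skyscraper x)) (y1 : sec1 (skyscraper x)) :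
    sect n y0 y1 -> sect n (f0 y0) (f1 y1).
  have [a [b abn]] := twist_witness n; rewrite /sect => /esym/(twistP _ _ abn) s.
  symmetry; apply/(twistP _ _ abn); rewrite /= /eval_hom res0Z res1C -w01.
  case h: (in0 x && in1 x); last first.
    have -> : res0 E w0 = 0.
      move/negbT: h; rewrite negb_and => /orP[] /negbTE h'.
        by move: n0; rewrite h' => ->; rewrite res00.
      by move: n1; rewrite h' w01 => ->; rewrite res10.
    by rewrite !scaler0.
  have zX m : 'X^m *: res0 E w0 = ((t_at x) ^+ m)%:P *: res0 E w0.
    by rewrite -!res0Z (scale_eigen 'X^m Xw0) hornerXn.
  rewrite scaleCA [RHS]scaleCA !zX !scalerA -!polyCM; congr (_%:P *: _).
  have sumX m (u : sky01 x) : \sum_i ('X^m *: u : 'rV[k]_(in0 x && in1 x)) 0 i =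
      t_at x ^+ m * \sum_i (u : 'rV[k]_(in0 x && in1 x)) 0 i.
    by rewrite mulr_sumr; apply: eq_bigr => i _; rewrite eval_scaleE mxE hornerXn.
  move/(congr1 (fun v : 'rV[k]_(in0 x && in1 x) => \sum_i v 0 i)): s.
  by rewrite !sumX !sum_restr // mulrC => ->; rewrite mulrC.
exists (glue_hom compat); apply: mono_homP => v; apply: eval_hom_eq0.
  by case: (in0 x) n0.
by case: (in1 x) n1.
Qed.

Lemma sum_rV_bool_inj (b : bool) (u v : 'rV[k]_b) : \sum_i u 0 i = \sum_i v 0 i -> u = v.
Proof.
move=> e; apply/eqP; rewrite -subr_eq0; apply/eqP/sum_rV_bool.
by under eq_bigr do rewrite !mxE; rewrite big_split sumrN /= e subrr.
Qed.

Lemma eval_module_false (a : k) (b : bool) : b = false -> forall v : eval_module a b, v = 0.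
Proof. by case: b => // _ v; apply/rowP => -[]. Qed.

Definition eval_one (a : k) (b : bool) : eval_module a b := const_mx 1 : 'rV[k]_b.

Lemma eval_one_gen (a : k) (b : bool) (v : eval_module a b) :
  v = (\sum_i (v : 'rV[k]_b) 0 i)%:P *: eval_one a b.
Proof.
case: b v => v; last by apply/rowP => -[].
by apply/rowP => i; rewrite eval_scaleE !mxE hornerC big_ord1 mulr1 ord1.
Qed.

Lemma eval_oneX (a : k) (b : bool) : 'X *: eval_one a b = a%:P *: eval_one a b.
Proof. by apply/rowP => i; rewrite !eval_scaleE !mxE hornerX hornerC. Qed.

(** Over each chart S_x is generated by one vector, whose image is an eigenvector or 0. If x lies in
    both charts the two images vanish together, so a nonzero morphism kills neither generator in a
    chart that contains x. *)
Lemma sky_hom_eigen E x (g : coh_hom (skyscraper x) E) :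
  ~ is_zero_hom g -> mono_hom g /\ eigen E x.
Proof.
move=> gn0; pose e0 : sec0 (skyscraper x) := eval_one (t_at x) (in0 x).
pose e1 : sec1 (skyscraper x) := eval_one (s_at x) (in1 x).
have g0E v : hom0 g v = (\sum_i (v : 'rV[k]_(in0 x)) 0 i)%:P *: hom0 g e0.
  by rewrite -hom0Z -eval_one_gen.
have g1E v : hom1 g v = (\sum_i (v : 'rV[k]_(in1 x)) 0 i)%:P *: hom1 g e1.
  by rewrite -hom1Z -eval_one_gen.
have X0 : 'X *: hom0 g e0 = (t_at x)%:P *: hom0 g e0 by rewrite -!hom0Z eval_oneX.
have X1 : 'X *: hom1 g e1 = (s_at x)%:P *: hom1 g e1 by rewrite -!hom1Z eval_oneX.
have tf (b : bool) : b \/ b = false by case: b; [left|right].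
have both : in0 x && in1 x -> hom0 g e0 = 0 <-> hom1 g e1 = 0.
  move=> h; have t0 := t_at_neq0 h.
  have r01 : res0 E (hom0 g e0) = res1 E (hom1 g e1).
    rewrite -hom_res0 -hom_res1; congr (hom01 g _); apply: sum_rV_bool_inj.
    rewrite !sum_restr //; have /andP[h0 h1] := h.
    by rewrite /e0 /e1 /eval_one h0 h1 !big_ord1 !mxE.
  split=> z.
    have /res1_ker[n] : res1 E (hom1 g e1) = 0 by rewrite -r01 z res00.
    rewrite (scale_eigen 'X^n X1) hornerXn => /scaleC_eq0[|//] /eqP.
    by rewrite expf_eq0 invr_eq0 (negbTE t0) andbF.
  have /res0_ker[n] : res0 E (hom0 g e0) = 0 by rewrite r01 z res10.
  rewrite (scale_eigen 'X^n X0) hornerXn => /scaleC_eq0[|//] /eqP.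
  by rewrite expf_eq0 (negbTE t0) andbF.
have n0 : in0 x -> hom0 g e0 <> 0.
  move=> h0 z; apply: gn0; apply: is_zero_homP => v; first by rewrite g0E z scaler0.
  rewrite g1E; have [h1|h1] := tf (in1 x).
    by rewrite (both _).1 ?scaler0 ?h0 ?h1.
  by rewrite (eval_module_false h1 e1) hom1_0 scaler0.
have n1 : in1 x -> hom1 g e1 <> 0.
  move=> h1 z; apply: gn0; apply: is_zero_homP => v; last by rewrite g1E z scaler0.
  rewrite g0E; have [h0|h0] := tf (in0 x).
    by rewrite (both _).2 ?scaler0 ?h0 ?h1.
  by rewrite (eval_module_false h0 e0) hom0_0 scaler0.
split.
  apply: mono_homP => v.
    rewrite g0E; have [h0|h0] := tf (in0 x); last by move=> _; apply: eval_module_false h0 _.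
    by move/scaleC_eq0=> [/sum_rV_bool//|]; have := n0 h0.
  rewrite g1E; have [h1|h1] := tf (in1 x); last by move=> _; apply: eval_module_false h1 _.
  by move/scaleC_eq0=> [/sum_rV_bool//|]; have := n1 h1.
case: x g e0 e1 {gn0 g0E g1E both} X0 X1 n0 n1 => [a|] g e0 e1 X0 X1 n0 n1.
  by exists (hom0 g e0) => //; apply: n0.
exists (hom1 g e1); first exact: n1.
by rewrite X1 /s_at /= invr0 polyC0 scale0r.
Qed.

Lemma eigen_skyscraper x y : eigen (skyscraper y) x -> x = y.
Proof.
have eval_eq (a b : k) (c : bool) (w : eval_module b c) :
    w <> 0 -> 'X *: w = a%:P *: w -> a = b.
  move=> wn0 Xw; apply/eqP; rewrite -subr_eq0; apply/contraT => ab0; case: wn0.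
  have : (a - b)%:P *: w = 0.
    have XE : 'X *: w = b%:P *: w by apply/rowP => i; rewrite !eval_scaleE hornerX hornerC.
    by rewrite polyCB scalerBl -Xw XE subrr.
  by move/scaleC_eq0=> [/eqP|//]; rewrite (negbTE ab0).
case: x => [a|] [w wn0 Xw].
  case: y w wn0 Xw => [b|] w wn0 Xw; last by case: wn0; apply: eval_module_false.
  by congr Some; apply: eval_eq wn0 Xw.
have s0 : s_at y = 0 by apply/esym/(eval_eq _ _ _ w wn0); rewrite polyC0 scale0r.
case: y s0 w wn0 Xw => // b /eqP; rewrite invr_eq0 => /eqP /= -> w wn0.
by case: wn0; apply: eval_module_false; rewrite /in1 eqxx.
Qed.

Lemma eigen_sect E x n : eigen E x ->
  exists (y0 : sec0 E) (y1 : sec1 E), sect n y0 y1 /\ ~ (y0 = 0 /\ y1 = 0).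
Proof.
move=> /eigen_sections[w0 [w1 [X0 X1 w01 n0 n1]]].
(* If the common restriction is 0, the two sections match for every n. *)
have [z0|z0] := eqVneq (res0 E w0) 0.
  exists w0, w1; split; first by rewrite /sect -w01 z0 twist0r.
  by case: x n0 n1 {X0 X1} => [a|] /= n0 n1 [].
have t0 : t_at x != 0.
  apply/eqP => t0; case/eqP: z0; apply: (@sec01_Xn_inj _ E 1).
  by rewrite /= -res0Z X0 t0 polyC0 scale0r res00 scaler0.
have zX m : 'X^m *: res0 E w0 = ((t_at x) ^+ m)%:P *: res0 E w0.
  by rewrite -!res0Z (scale_eigen 'X^m X0) hornerXn.
have [a [b abn]] := twist_witness n.
(* On the eigenvector, twisting by n = a - b is multiplication by t(x)^a / t(x)^b, which the two
   constants compensate. *)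
exists ((t_at x ^+ b)%:P *: w0), ((t_at x ^+ a)%:P *: w1); split.
  rewrite /sect; symmetry; apply/(twistP _ _ abn).
  by rewrite res0Z res1C -w01 scaleCA [RHS]scaleCA !zX scaleCA.
move=> [/scaleC_eq0[/eqP h|w00] _]; first by move: h; rewrite expf_eq0 (negbTE t0) andbF.
by case/eqP: z0; rewrite w00 res00.
Qed.

End Skyscrapers.

(** * Line bundles *)


Section LineBundles.
Variable k : fieldType.
Implicit Types (E Y : coh k).

Local Notation O n := (line_bundle k n).

Lemma rev_polyK d (p : {poly k}) : (size p <= d.+1)%N -> rev_poly d (rev_poly d p) = p.
Proof.
move=> pd; apply/polyP => i; rewrite coef_poly ltnS; case: leqP => id.
  by rewrite coef_poly ltnS leq_subr subKn.
by rewrite nth_default // (leq_trans pd).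
Qed.

Lemma size_rev_poly d (p : {poly k}) : (size (rev_poly d p) <= d.+1)%N.
Proof. exact: size_poly. Qed.

Lemma rev_scale_res1 E d (p : {poly k}) (m : sec1 E) : (size p <= d.+1)%N ->
  'X^d *: res1 E (p *: m) = rev_poly d p *: res1 E m.
Proof. by move=> pd; rewrite (scale_res1 m (size_rev_poly d p)) rev_polyK. Qed.

Lemma twistZ E n (p : {poly k}) (z : sec01 E) : twist n (p *: z) = p *: twist n z.
Proof. exact: linear_scale. Qed.

(* The membership [sect m (p *: y0) (q *: y1)] depends on [y0] and [y1] only
   through an identity of polynomials. *)
Lemma sect_scale E n m d (a b c e : nat) (y0 : sec0 E) (y1 : sec1 E) (p q : {poly k}) :
  sect n y0 y1 -> a%:Z = b%:Z + n -> c%:Z = e%:Z + m -> (size q <= d.+1)%N ->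
  sect m (p *: y0) (q *: y1) <->
  (rev_poly d q * 'X^(a + e)) *: res0 E y0 = (p * 'X^(d + c + b)) *: res0 E y0.
Proof.
move=> s abn cem qd; rewrite /sect.
have lhs : 'X^(b + e + d) *: res1 E (q *: y1) = (rev_poly d q * 'X^(a + e)) *: res0 E y0.
  rewrite exprD -scalerA rev_scale_res1 // s scaleCA -scalerA; congr (_ *: _).
  by rewrite exprD mulrC -scalerA (twistX _ abn) scalerA -exprD addnC.
have rhs : 'X^(b + e + d) *: twist m (res0 E (p *: y0)) = (p * 'X^(d + c + b)) *: res0 E y0.
  rewrite res0Z twistZ scaleCA -[RHS]scalerA; congr (_ *: _).
  have -> : (b + e + d = d + b + e)%N by lia.
  by rewrite exprD -scalerA (twistX _ cem) scalerA -exprD addnAC.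
rewrite -lhs -rhs; split=> [-> //|]; exact: sec01_Xn_inj.
Qed.

Definition one0 n : sec0 (O n) := (1 : {poly k}^o).
Definition one1 n : sec1 (O n) := (1 : {poly k}^o).

Lemma scale_one0 n (p : sec0 (O n)) : (p : {poly k}) *: one0 n = p.
Proof. exact: mulr1. Qed.
Lemma scale_one1 n (p : sec1 (O n)) : (p : {poly k}) *: one1 n = p.
Proof. exact: mulr1. Qed.

Lemma line_torsion_free n (p : {poly k}) : p *: res0 (O n) (one0 n) = 0 -> p = 0.
Proof.
rewrite -res0Z scale_one0 => /(congr1 val) /= /eqP.
by rewrite tofrac_eq0 => /eqP.
Qed.

Lemma sect_one n : sect n (one0 n) (one1 n).
Proof.
have [a [b abn]] := twist_witness n; rewrite /sect; symmetry; apply/(twistP _ _ abn).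
apply: val_inj; rewrite /= !tofracXn tofrac1 mulr1 at_tinvC tofrac1 mulr1.
by rewrite exprnP abn expfzDr ?t_neq0.
Qed.

(** Tested on the generators of O(n), matching of p and q is an honest identity of polynomials,
    because O(n) is torsion-free; the identity then applies to any E. *)
Lemma line_sect E n m (y0 : sec0 E) (y1 : sec1 E) (p : sec0 (O n)) (q : sec1 (O n)) :
  sect n y0 y1 -> sect m p q -> sect m ((p : {poly k}) *: y0) ((q : {poly k}) *: y1).
Proof.
have [a [b abn]] := twist_witness n; have [c [e cem]] := twist_witness m => s spq.
have : sect m ((p : {poly k}) *: one0 n) ((q : {poly k}) *: one1 n).
  by rewrite scale_one0 scale_one1.
move/(sect_scale _ (sect_one n) abn cem (leqnSn _)) => /eqP.
rewrite -subr_eq0 -scalerBl => /eqP /line_torsion_free /eqP; rewrite subr_eq0 => /eqP id.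
apply/(sect_scale _ s abn cem (leqnSn _)).
by rewrite id.
Qed.

Section LineHom.
Variables (E : coh k) (n : int) (y0 : sec0 E) (y1 : sec1 E).
Hypothesis s : sect n y0 y1.

Definition scale_fun (M : lmodType {poly k}) (y : M) (p : {poly k}^o) : M := (p : {poly k}) *: y.
Lemma scale_fun_is_linear (M : lmodType {poly k}) (y : M) : linear (scale_fun y).
Proof. by move=> p u v; rewrite /scale_fun scalerDl -scalerA. Qed.
HB.instance Definition _ (M : lmodType {poly k}) (y : M) :=
  GRing.isLinear.Build {poly k} {poly k}^o M _ (scale_fun y) (scale_fun_is_linear y).

Definition line_hom : coh_hom (O n) E :=
  @glue_hom k (O n) E (scale_fun y0) (scale_fun y1) (fun m p q => @line_sect E n m y0 y1 p q s).

End LineHom.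

(* [Hom(O(n), E) = 0] *)
Definition no_sect E n : Prop := forall (y0 : sec0 E) (y1 : sec1 E),
  sect n y0 y1 -> y0 = 0 /\ y1 = 0.

Lemma line_hom_zero E n (f : coh_hom (O n) E) : no_sect E n -> is_zero_hom f.
Proof.
move=> /(_ _ _ (hom_sect f (sect_one n))) [z0 z1]; apply: is_zero_homP => m.
  by rewrite -[m]scale_one0 hom0Z z0 scaler0.
by rewrite -[m]scale_one1 hom1Z z1 scaler0.
Qed.

Lemma no_sectP E n : (forall f : coh_hom (O n) E, is_zero_hom f) -> no_sect E n.
Proof.
move=> fz y0 y1 s; have [z0 z1 _] := fz (line_hom s).
have := z0 (one0 n); have := z1 (one1 n).
by rewrite /= /scale_fun !scale1r => -> ->.
Qed.

(** A morphism from O(n + 1) is composed with the two coordinate maps from O(n): one is the identity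
    over U0 and detects y0, the other is the identity over U1 and detects y1. *)
Lemma no_sectS E n : no_sect E n -> no_sect E (n + 1).
Proof.
move=> En y0 y1 s; split.
  have [|->//] := En y0 ('X *: y1).
  by rewrite /sect res1_X s -twistD addrCA addNr addr0.
have [|_ ->//] := En ('X *: y0) y1.
by rewrite /sect res0Z s twistD.
Qed.

Lemma no_sect_le E n m : n <= m -> no_sect E n -> no_sect E m.
Proof.
move=> nm En; have -> : m = n + `|m - n|%N by lia.
elim: `|_|%N => [|d IH]; first by rewrite addr0.
have -> : n + d.+1 = (n + d) + 1 by lia.
exact: no_sectS.
Qed.

Lemma no_sect_mono E Y n (f : coh_hom E Y) : mono_hom f -> no_sect Y n -> no_sect E n.
Proof.
move=> [i0 i1] Yn y0 y1 /(hom_sect f)/Yn[z0 z1].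
by split; [apply: (i0)|apply: (i1)]; rewrite ?hom0_0 ?hom1_0.
Qed.

Lemma no_sect_eigen E n x : no_sect E n -> ~ eigen E x.
Proof. by move=> En /(eigen_sect n)[y0 [y1 [s]]]; apply; apply: En. Qed.

(** The pair y is a section with values in the line spanned by w, up to the denominators p0 and p1.
    Sizes exceed degrees by one, so the inequality reads m + deg p0 + deg p1 < n: denominators of
    these degrees cannot make up for the difference n - m. *)
Lemma sect_degree_bound E m n (w0 : sec0 E) (w1 : sec1 E) (y0 : sec0 E) (y1 : sec1 E)
    (p0 p1 a b : {poly k}) :
  (forall p : {poly k}, p *: res0 E w0 = 0 -> p = 0) ->
  sect m w0 w1 -> sect n y0 y1 -> p0 *: y0 = a *: w0 -> p1 *: y1 = b *: w1 ->
  p0 != 0 -> p1 != 0 -> m + (size p0)%:Z + (size p1)%:Z < n + 2 -> a = 0.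
Proof.
move=> tfw sw sy e0 e1 p00 p10 deg; apply/eqP/contraT => a0.
have mn : m <= n.
  by move: p00 p10; rewrite -!size_poly_gt0; lia.
pose j := `|n - m|%N; have nE : n = m + j by rewrite /j; lia.
pose d := maxn (size p1) (size b).
have dp : (size p1 <= d.+1)%N by rewrite ltnW // ltnS leq_maxl.
have db : (size b <= d.+1)%N by rewrite ltnW // ltnS leq_maxr.
(* Both sides are the coefficient of w0 in the section y multiplied by both denominators, computed
   on U0 and on U1. *)
have : rev_poly d p1 * a * 'X^j = rev_poly d b * p0.
  apply/eqP; rewrite -subr_eq0; apply/eqP/tfw; apply: (@twist_inj _ E m).
  rewrite twist0r scalerBl twistB !twistZ; apply/eqP; rewrite subr_eq0; apply/eqP.
  have := rev_scale_res1 y1 dp; rewrite e1 rev_scale_res1 // sw sy.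
  move/(congr1 (fun z => p0 *: z)); rewrite /= [p0 *: (_ *: twist m _)]scalerA [p0 * _]mulrC.
  move=> ->; rewrite [RHS]scaleCA -[p0 *: _]twistZ -res0Z e0 res0Z nE twistD twist_nat.
  by rewrite -!scalerA !twistZ [X in _ *: X]scaleCA.
move/(congr1 (fun p : {poly k} => size p)).
(* The leading coefficient of [p1] becomes the coefficient of t^(d - deg p1) in the reversed
   polynomial. *)
have szr : (d + 2 <= size (rev_poly d p1) + size p1)%N.
  have s1 : (0 < size p1)%N by rewrite size_poly_gt0.
  suff : (d - (size p1).-1 < size (rev_poly d p1))%N by lia.
  rewrite ltnNge; apply/negP => /(nth_default 0)/eqP.
  rewrite coef_poly ltnS leq_subr subKn; last by lia.
  by rewrite -[_`__]/(lead_coef p1) lead_coef_eq0 (negbTE p10).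
have r0 : rev_poly d p1 != 0 by rewrite -size_poly_gt0; lia.
rewrite size_mulXn ?mulf_neq0 // size_mul // => sE.
have := size_polyMleq (rev_poly d b) p0; rewrite -sE.
have := size_rev_poly d b; move: a0 p00; rewrite -!size_poly_gt0.
move: deg szr; rewrite nE; clearbody d j.
move: (size (rev_poly d p1)) (size a) (size (rev_poly d b)) (size p0) (size p1).
by clear=> *; lia.
Qed.

Lemma line_no_eigen n x : ~ eigen (O n) x.
Proof.
case: x => [a|] [w wn0 Xw]; apply: wn0; apply/eqP.
  have : ('X - a%:P) * (w : {poly k}) = 0.
    by rewrite mulrBl; apply/eqP; rewrite subr_eq0; apply/eqP.
  by move/eqP; rewrite mulf_eq0 polyXsubC_eq0.
by move/eqP: Xw; rewrite -[_ *: _]/('X * (w : {poly k})) mulf_eq0 polyX_eq0.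
Qed.

(** This is the degree bound with trivial denominators, w being the pair of generators of O(n). *)
Lemma no_sect_line n m : n < m -> no_sect (O n) m.
Proof.
move=> nm p q s; have p0 : p = 0.
  apply: (@sect_degree_bound _ n m (one0 n) (one1 n) p q 1 1 p q) => //.
  - exact: line_torsion_free.
  - exact: sect_one.
  - by rewrite scale1r scale_one0.
  - by rewrite scale1r scale_one1.
  - exact: oner_neq0.
  - exact: oner_neq0.
  - by rewrite size_poly1; lia.
split=> //; have /res1_ker[j] : res1 (O n) q = 0 by rewrite s p0 res00 twist0r.
by move/eqP; rewrite -[_ *: _]/('X^j * (q : {poly k})) mulf_eq0 expf_eq0 polyX_eq0 andbF => /eqP.
Qed.

(* [H^1(O(-1)) = 0]: every Laurent polynomial is the sum of its parts of degree
   at most [m] and at least [m + 1]. *)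
Lemma line_laurent_split m (l : sec01 (O m)) :
  exists (p : sec0 (O m)) (q : sec1 (O m)),
    l = res1 (O m) q + twist (m + 1) (res0 (O m) p).
Proof.
have [N0 [P0 e]] := res0_im l; set z := res0 (O m) (one0 m).
(* Besides clearing the denominator of [l], N is taken large enough for d = N + m to be a natural
   number. *)
have [N [d [P [dN eP]]]] : exists (N d : nat) (P : {poly k}),
    d%:Z = N%:Z + m /\ 'X^N *: l = P *: z.
  exists (N0 + absz m)%N, (absz (N0%:Z + (absz m)%:Z + m)), ('X^(absz m) * P0); split; first by lia.
  by rewrite addnC exprD -!scalerA e /z -[P0 *: _]res0Z scale_one0.
(* Division by t^(d + 1) cuts P above degree d, which is degree m once t^N is divided out. *)
pose r := P %% 'X^(d.+1); pose p := P %/ 'X^(d.+1); pose q := rev_poly d r.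
have rd : (size r <= d.+1)%N.
  by rewrite -ltnS -(size_polyXn k d.+1) ltn_modp expf_eq0 polyX_eq0 andbF.
have PE : P = r + p * 'X^(d.+1) by rewrite addrC -divp_eq.
exists p, q; apply: (@sec01_Xn_inj _ (O m) N); cbv beta; rewrite eP PE scalerDl scalerDr.
congr (_ + _).
  apply: (@twist_inj _ _ m); rewrite twistZ -sect_one -(twist_nat N) -twistD addrC -dN.
  by rewrite (scale_res1 _ rd) scale_one1.
rewrite -(twist_nat N) -twistD addrA -dN -[in RHS](scale_one0 p) res0Z twistZ.
by rewrite -scalerA addrC (_ : 1 + d%:Z = d.+1) //; lia.
Qed.

End LineBundles.

(** * Torsion sheaves *)


Section Devissage.
Variable k : closedFieldType.
Implicit Types (E S W X Y Z : coh k) (C : coh k -> Prop) (x : P1 k) (P Q : P1 k -> Prop).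

Local Notation O n := (line_bundle k n).

Definition torsion_elt (M : lmodType {poly k}) (w : M) : Prop :=
  exists2 p : {poly k}, p != 0 & p *: w = 0.

(** For an annihilator p = (X - a) q of least size, q w is nonzero by minimality and is killed by X
    - a. *)
Lemma minimal_annihilator (M : lmodType {poly k}) (w : M) : torsion_elt w ->
  exists p : {poly k}, [/\ p != 0, p *: w = 0 &
    forall a, root p a -> exists2 v : M, v <> 0 & 'X *: v = a%:P *: v].
Proof.
move=> [p0 p00 p0w]; pose R n := `[< exists p : {poly k}, [/\ p != 0, p *: w = 0 & size p = n] >].
have exR : exists n, R n by exists (size p0); apply/asboolP; exists p0.
case: (ex_minnP exR) => n /asboolP[p [pn0 pw sp]] nmin; exists p; split=> // a.
case/factor_theorem=> q pq; exists (q *: w) => [qw|]; last first.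
  apply/eqP; rewrite -subr_eq0 -scalerBl scalerA mulrC -pq pw //.
have q0 : q != 0 by apply: contraNneq pn0 => q0; rewrite pq q0 mul0r.
have := nmin (size q); have -> : R (size q) by apply/asboolP; exists q.
by move=> /(_ isT); rewrite -sp pq size_Mmonic ?monicXsubC // size_XsubC addn2 ltnn.
Qed.

(** Algebraic closedness enters here: the minimal annihilator of a nonzero element is not constant,
    hence has a root. *)
Lemma torsion_eigenvector (M : lmodType {poly k}) (w : M) : torsion_elt w -> w <> 0 ->
  exists a, exists2 v : M, v <> 0 & 'X *: v = a%:P *: v.
Proof.
move=> /minimal_annihilator[p [p0 pw proot]] wn0.
have [/eqP/size_poly1P[c c0 pc]|sp] := eqVneq (size p) 1.
  by case: wn0; move: pw; rewrite pc => /scaleC_eq0[/eqP|//]; rewrite (negbTE c0).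
by have [a /proot] := closed_rootP p sp; exists a.
Qed.

Definition torsion_free E : Prop := forall x, ~ eigen E x.

(** For b nonzero the point is t = 1/b; its eigenvector over U0 comes from [v] by clearing the pole
    at t = 0 and then the part killed by a power of t. *)
Lemma eigen_chart1 E (b : k) (v : sec1 E) :
  v <> 0 -> 'X *: v = b%:P *: v -> exists x, eigen E x.
Proof.
have [->|b0] := eqVneq b 0 => vn0 Xv; first by exists None, v => //; rewrite Xv polyC0 scale0r.
exists (Some b^-1); have zb : b%:P *: ('X *: res1 E v) = res1 E v.
  by rewrite scaleCA -res1C -Xv res1X.
have [n [m zm]] := res0_im (res1 E v).
have /res0_ker[l e] : res0 E (b%:P *: ('X *: m) - m) = 0.
  by rewrite res0B !res0Z -zm ['X *: ('X^n *: _)]scaleCA scaleCA zb subrr.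
exists ('X^l *: m) => [w0|].
  apply: vn0; have /res1_ker[j] : res1 E v = 0.
    by apply: (@sec01_Xn_inj _ E (l + n)); rewrite scaler0 exprD -scalerA zm -res0Z w0 res00.
  rewrite (scale_eigen 'X^j Xv) hornerXn => /scaleC_eq0[|//] /eqP.
  by rewrite expf_eq0 (negbTE b0) andbF.
have bX : b%:P *: ('X *: ('X^l *: m)) = 'X^l *: m.
  move/eqP: e; rewrite scalerBr subr_eq0 => /eqP e.
  by rewrite -[RHS]e [RHS]scaleCA; congr (_ *: _); apply: scaleCA.
by rewrite -[in RHS]bX [RHS]scalerA -polyCM mulVf // scale1r.
Qed.

Lemma torsion_free0 E (w : sec0 E) : torsion_free E -> torsion_elt w -> w = 0.
Proof.
move=> tfE tw; apply: contrapT => wn0.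
by have [a [v vn0 Xv]] := torsion_eigenvector tw wn0; apply: (tfE (Some a)); exists v.
Qed.

Lemma torsion_free1 E (w : sec1 E) : torsion_free E -> torsion_elt w -> w = 0.
Proof.
move=> tfE tw; apply: contrapT => wn0.
have [a [v vn0 Xv]] := torsion_eigenvector tw wn0.
by have [x] := eigen_chart1 vn0 Xv; apply: tfE.
Qed.

Lemma torsion_elt_Xn (M : lmodType {poly k}) (w : M) : (exists n, 'X^n *: w = 0) -> torsion_elt w.
Proof. by move=> [n e]; exists 'X^n => //; rewrite expf_eq0 polyX_eq0 andbF. Qed.

Lemma torsion_free_sect E n (y0 : sec0 E) (y1 : sec1 E) :
  torsion_free E -> sect n y0 y1 -> y0 = 0 <-> y1 = 0.
Proof.
move=> tfE s; split=> z.
  by apply: torsion_free1 => //; apply/torsion_elt_Xn/res1_ker; rewrite s z res00 twist0r.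
apply: torsion_free0 => //; apply/torsion_elt_Xn/res0_ker.
by apply: (@twist_inj _ E n); rewrite -s z res10 twist0r.
Qed.

Lemma eigen_mono X Y (f : coh_hom X Y) x : mono_hom f -> eigen X x -> eigen Y x.
Proof.
move=> [i0 i1]; case: x => [a|] [w wn0 Xw].
  exists (hom0 f w); last by rewrite -!hom0Z Xw.
  by move=> fw; apply: wn0; apply: (i0); rewrite hom0_0.
exists (hom1 f w); last by rewrite -!hom1Z Xw hom1_0.
by move=> fw; apply: wn0; apply: (i1); rewrite hom1_0.
Qed.

(* The torsion sheaves supported in [Q]; only the point at infinity has to be
   looked at in the second chart. *)
Definition torsion_on Q E : Prop :=
  (forall w : sec0 E, exists p : {poly k},
     [/\ p != 0, p *: w = 0 & forall a, root p a -> Q (Some a)]) /\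
  (forall w : sec1 E, exists p : {poly k},
     [/\ p != 0, p *: w = 0 & root p 0 -> Q None]).

Definition torsion E : Prop :=
  (forall w : sec0 E, torsion_elt w) /\ (forall w : sec1 E, torsion_elt w).

Lemma torsion_on_torsion Q E : torsion_on Q E -> torsion E.
Proof.
move=> [t0 t1]; split=> w.
  by have [p [p0 pw _]] := t0 w; exists p.
by have [p [p0 pw _]] := t1 w; exists p.
Qed.

(** Each root of a minimal annihilator is an eigenvalue, so it cannot lie in P. *)
Lemma torsion_torsion_on P E :
  torsion E -> (forall x, P x -> ~ eigen E x) -> torsion_on (fun x => ~ P x) E.
Proof.
move=> [t0 t1] noE; split=> w.
  have [p [p0 pw proot]] := minimal_annihilator (t0 w); exists p; split=> // a.
  by move/proot=> e /noE; apply.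
have [p [p0 pw proot]] := minimal_annihilator (t1 w); exists p; split=> //.
by move/proot=> [v vn0 Xv] /noE; apply; exists v => //; rewrite Xv polyC0 scale0r.
Qed.

Lemma torsion_on_epi Q X Y (g : coh_hom X Y) : epi_hom g -> torsion_on Q X -> torsion_on Q Y.
Proof.
move=> [s0 s1] [t0 t1]; split=> w.
  have [v <-] := s0 w; have [p [p0 pv proot]] := t0 v.
  by exists p; rewrite -hom0Z pv hom0_0.
have [v <-] := s1 w; have [p [p0 pv proot]] := t1 v.
by exists p; rewrite -hom1Z pv hom1_0.
Qed.

Lemma torsion_on_eigen Q X x : torsion_on Q X -> eigen X x -> Q x.
Proof.
move=> [t0 t1]; case: x => [a|] [w wn0 Xw].
  have [p [_ pw]] := t0 w; apply; rewrite rootE.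
  by move: pw; rewrite (scale_eigen p Xw) => /scaleC_eq0[->|].
have [p [_ pw]] := t1 w; apply; rewrite rootE.
have Xw0 : 'X *: w = 0%:P *: w by rewrite Xw polyC0 scale0r.
by move: pw; rewrite (scale_eigen p Xw0) => /scaleC_eq0[->|].
Qed.

Lemma torsion_epi X Y (g : coh_hom X Y) : epi_hom g -> torsion X -> torsion Y.
Proof.
move=> [s0 s1] [t0 t1]; split=> w.
  by have [v <-] := s0 w; have [p p0 pv] := t0 v; exists p; rewrite // -hom0Z pv hom0_0.
by have [v <-] := s1 w; have [p p0 pv] := t1 v; exists p; rewrite // -hom1Z pv hom1_0.
Qed.

Lemma torsion_ext : ext_closed torsion.
Proof.
move=> X Z Y f g [[_ e0 _] [_ e1 _] _] [tX0 tX1] [tY0 tY1]; split=> w.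
  have [p p0 pw] := tY0 (hom0 g w); have /e0[u uw] : hom0 g (p *: w) = 0 by rewrite hom0Z.
  have [q q0 qu] := tX0 u; exists (q * p); first exact: mulf_neq0.
  by rewrite -scalerA -uw -hom0Z qu hom0_0.
have [p p0 pw] := tY1 (hom1 g w); have /e1[u uw] : hom1 g (p *: w) = 0 by rewrite hom1Z.
have [q q0 qu] := tX1 u; exists (q * p); first exact: mulf_neq0.
by rewrite -scalerA -uw -hom1Z qu hom1_0.
Qed.

Lemma torsion_skyscraper x : torsion (skyscraper x).
Proof.
have tors (a : k) (b : bool) (w : eval_module a b) : torsion_elt w.
  exists ('X - a%:P); first by rewrite polyXsubC_eq0.
  by apply/rowP => i; rewrite eval_scaleE !mxE !hornerE subrr mul0r.
by split=> w; apply: tors.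
Qed.

Lemma torsion_torsion_free_zero W : torsion W -> torsion_free W -> is_zero_obj W.
Proof.
move=> [t0 t1] tfW; apply: is_zero_objP => w; first exact: torsion_free0.
exact: torsion_free1.
Qed.

Lemma skyscraper_neq0 x : ~ is_zero_obj (skyscraper x).
Proof.
move=> [z0 z1 _]; have /eqP : x != x; last by [].
case: x z0 z1 => [a|] z0 z1.
  have /rowP/(_ 0) := z0 (eval_one a true); rewrite !mxE => /eqP.
  by rewrite oner_eq0.
have /rowP/(_ 0) := z1 (eval_one (s_at (None : P1 k)) true); rewrite !mxE => /eqP.
by rewrite oner_eq0.
Qed.

Lemma line_neq0 n : ~ is_zero_obj (O n).
Proof. by move=> [z0 _ _]; have /eqP := z0 (one0 k n); rewrite oner_eq0. Qed.

(** What induction over quotients asks of a target class: zero objects for the end, extensions for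
    the step. *)
Definition ext_class C : Prop :=
  [/\ iso_closed C, ext_closed C & forall E, is_zero_obj E -> C E].

Lemma torsion_class : ext_class torsion.
Proof.
split; [|exact: torsion_ext|].
  by move=> X Y /iso_epi[f] fe; apply: torsion_epi fe.
move=> E [z0 z1 _]; split=> w; exists 1; by rewrite ?oner_neq0.
Qed.

(** This makes dividing out a nonzero subsheaf a legitimate step of [quotient_ind]. *)
Lemma coker_not_mono X Z Y (f : coh_hom X Z) (g : coh_hom Z Y) :
  is_zero_hom (comp_hom g f) -> mono_hom f -> ~ is_zero_obj X -> ~ mono_hom g.
Proof.
move=> z fm Xn0 [i0 i1]; apply: Xn0; apply: (zero_hom_mono_zero fm).
by have [z0 z1 _] := z; apply: is_zero_homP => m; [apply: (i0)|apply: (i1)];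
  rewrite ?hom0_0 ?hom1_0; [apply: z0|apply: z1].
Qed.

Lemma torsion_on_mem Q C W : ext_class C -> (forall x, Q x -> C (skyscraper x)) ->
  torsion_on Q W -> C W.
Proof.
move=> [_ Cext C0] CQ; elim/quotient_ind: W => W IH tW.
have [[x ex]|tfW] := pselect (exists x, eigen W x); last first.
  apply: C0; apply: torsion_torsion_free_zero; first exact: torsion_on_torsion tW.
  by move=> x ex; apply: tfW; exists x.
have [i im] := eigen_sky_hom ex; have ex_i := coker_exact im.1 im.2.
have ep := short_exact_epi ex_i.
apply: (Cext _ _ _ _ _ ex_i); first exact/CQ/(torsion_on_eigen tW ex).
apply: (IH _ _ ep); last exact: torsion_on_epi ep tW.
exact: coker_not_mono (short_exact_comp0 ex_i) im (@skyscraper_neq0 x).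
Qed.

(** Subsheaves from G are divided out until none is left, which terminates by Noetherian induction;
    what has been divided out is an iterated extension of members of G. *)
Lemma devissage (G : coh k -> Prop) C Z : ext_class C -> (forall S, G S -> C S) ->
  (forall S, G S -> ~ is_zero_obj S) ->
  exists X Y (f : coh_hom X Z) (g : coh_hom Z Y),
    [/\ C X, (forall S (i : coh_hom S Y), G S -> ~ mono_hom i) & short_exact f g].
Proof.
move=> [Ciso Cext C0] CG Gn0; elim/quotient_ind: Z => Z IH.
have [[S [GS [i im]]]|none] := pselect (exists S, G S /\ exists i : coh_hom S Z, mono_hom i);
  last first.
  (* Nothing is left to divide out: X is the zero sheaf, obtained as the kernel of the identity. *)
  have ez : short_exact (ker_incl (id_hom Z)) (id_hom Z) by apply: ker_exact => w; exists w.
  exists (ker_coh (id_hom Z)), Z, (ker_incl (id_hom Z)), (id_hom Z); split=> //.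
    apply: C0; apply: (zero_hom_mono_zero (short_exact_mono ez)).
    have [z0 z1 _] := short_exact_comp0 ez.
    by apply: is_zero_homP => m; [apply: z0|apply: z1].
  by move=> S i GS im; apply: none; exists S; split=> //; exists i.
have ei := coker_exact im.1 im.2; set p := coker_proj i in ei.
have pnm := coker_not_mono (short_exact_comp0 ei) im (Gn0 _ GS).
have [X' [Y' [f' [g' [CX' noY' e']]]]] := IH _ p (short_exact_epi ei) pnm.
pose h := comp_hom g' p; have [g'0 g'1] := short_exact_epi e'.
have [p0 p1] := short_exact_epi ei.
have [K [kf eh]] : exists K (kf : coh_hom K Z), short_exact kf h.
  exists (ker_coh h), (ker_incl h); apply: ker_exact => w;
    [have [v <-] := g'0 w|have [v <-] := g'1 w].
    by have [u <-] := p0 v; exists u.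
  by have [u <-] := p1 v; exists u.
exists K, Y', kf, h; split=> //.
have [ip0' ip1' _] := short_exact_comp0 ei.
have ip0 m : hom0 p (hom0 i m) = 0 by apply: ip0'.
have ip1 m : hom1 p (hom1 i m) = 0 by apply: ip1'.
have [j [j0 j1]] : exists j : coh_hom S K,
    (forall m, hom0 kf (hom0 j m) = hom0 i m) /\
    (forall m, hom1 kf (hom1 j m) = hom1 i m).
  apply: (factor_kernel eh); apply: is_zero_homP => m /=.
    by rewrite (ip0 m) hom0_0.
  by rewrite (ip1 m) hom1_0.
have [hz0 hz1 _] := short_exact_comp0 eh.
have [q [q0 q1]] : exists q : coh_hom K X',
    (forall m, hom0 f' (hom0 q m) = hom0 (comp_hom p kf) m) /\
    (forall m, hom1 f' (hom1 q m) = hom1 (comp_hom p kf) m).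
  by apply: (factor_kernel e'); apply: is_zero_homP => m; [apply: hz0|apply: hz1].
have [f'i0 f'i1] := short_exact_mono e'.
have [ki0 ki1] := short_exact_mono eh.
have [[_ ei0 _] [_ ei1 _] _] := ei.
have [[_ e'0 _] [_ e'1 _] _] := e'.
have [[_ eh0 _] [_ eh1 _] _] := eh.
(* The kernel K of Z -> Y' has S as a subsheaf with quotient X', the part removed from Z/S. *)
apply: (Cext S _ X' j q) => //; last exact: CG.
apply: short_exactP; split.
- by move=> u v uv; apply: (im.1); rewrite -!j0 uv.
- move=> v; split=> [qv|[u uv]].
    have /ei0[s sv] : hom0 p (hom0 kf v) = 0.
      by move: (q0 v) => /= <-; rewrite qv hom0_0.
    by exists s; apply: (ki0); rewrite j0.
  by apply: (f'i0); rewrite hom0_0 q0 -uv /= j0; apply: ip0.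
- move=> w; have [v vw] := p0 (hom0 f' w).
  have /eh0[u uv] : hom0 h v = 0 by rewrite /= vw; apply/e'0; exists w.
  by exists u; apply: (f'i0); rewrite q0 /= uv.
- by move=> u v uv; apply: (im.2); rewrite -!j1 uv.
- move=> v; split=> [qv|[u uv]].
    have /ei1[s sv] : hom1 p (hom1 kf v) = 0.
      by move: (q1 v) => /= <-; rewrite qv hom1_0.
    by exists s; apply: (ki1); rewrite j1.
  by apply: (f'i1); rewrite hom1_0 q1 -uv /= j1; apply: ip1.
- move=> w; have [v vw] := p1 (hom1 f' w).
  have /eh1[u uv] : hom1 h v = 0 by rewrite /= vw; apply/e'1; exists w.
  by exists u; apply: (f'i1); rewrite q1 /= uv.
Qed.

End Devissage.

(** * Vector bundles *)


Section VectorBundles.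
Variable k : closedFieldType.
Implicit Types (E S W X Y Z : coh k) (C : coh k -> Prop) (x : P1 k) (P Q : P1 k -> Prop).

Local Notation O n := (line_bundle k n).

Lemma exists_sect Y : ~ is_zero_obj Y -> exists n, ~ no_sect Y n.
Proof.
move=> Yn0; apply: contrapT => /forallNP none; apply: Yn0; apply: is_zero_objP => m.
  by have [n [y1 /(contrapT (none _))[]]] := res1_im_sect m.
by have [n [y0 /(contrapT (none _))[]]] := res0_im_sect m.
Qed.

Lemma line_hom_mono Y n (y0 : sec0 Y) (y1 : sec1 Y) (s : sect n y0 y1) :
  torsion_free Y -> ~ (y0 = 0 /\ y1 = 0) -> mono_hom (line_hom s).
Proof.
move=> tfY yn0; have zz := torsion_free_sect tfY s.
have y00 : y0 <> 0 by move=> z; apply: yn0; split=> //; apply/zz.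
have y10 : y1 <> 0 by move=> z; apply: yn0; split=> //; apply/zz.
apply: mono_homP => p py; apply/eqP/contraT => p0.
  by case: y00; apply: torsion_free0 => //; exists (p : {poly k}).
by case: y10; apply: torsion_free1 => //; exists (p : {poly k}).
Qed.

(* Since [H^1(O(-1)) = 0], pairs of degree [m + 1] lift along the quotient by [O(m)]. *)
Lemma no_sect_quotient m Y Y' (f : coh_hom (O m) Y) (g : coh_hom Y Y') :
  short_exact f g -> no_sect Y (m + 1) -> no_sect Y' (m + 1).
Proof.
move=> e noY y0 y1 s; have [s0 s1] := short_exact_epi e.
have [z0 z1 _] := short_exact_comp0 e; have [_ _ [_ e01 _]] := e.
have [v0 v0y] := s0 y0; have [v1 v1y] := s1 y1.
(* The mismatch of the lifts comes from O(m) over the overlap. Splitting it into a part from each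
   chart corrects [v0] and [v1] separately, without changing their images in Y'. *)
have /e01[l lE] : hom01 g (res1 Y v1 - twist (m + 1) (res0 Y v0)) = 0.
  by rewrite hom01B hom01_twist hom_res1 hom_res0 v0y v1y s subrr.
have [p [q lpq]] := line_laurent_split l.
have [|w0 w1] := noY (v0 - hom0 f (- p)) (v1 - hom1 f q).
  have N0 : hom01 f (twist (m + 1) (res0 _ (- p))) = - hom01 f (twist (m + 1) (res0 _ p)).
    by rewrite -[- p]sub0r res0B res00 twistB twist0r hom01B hom01_0 sub0r.
  have D0 : hom01 f l = hom01 f (res1 _ q) + hom01 f (twist (m + 1) (res0 _ p)).
    by rewrite [in LHS]lpq; apply: raddfD.
  rewrite /sect res1B res0B twistB -hom_res1 -hom_res0 -hom01_twist N0 opprK.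
  apply/eqP; rewrite subr_eq -addrA [X in _ == X]addrC -subr_eq -lE D0.
  by rewrite addrC.
rewrite -v0y -v1y; split.
  by rewrite -[v0](subrK (hom0 f (- p))) w0 add0r; apply: z0.
by rewrite -[v1](subrK (hom1 f q)) w1 add0r; apply: z1.
Qed.

Lemma line_subsheaf Y n : ~ is_zero_obj Y -> no_sect Y n ->
  exists l Y' (f : coh_hom (O l) Y) (g : coh_hom Y Y'),
    [/\ l < n, short_exact f g & no_sect Y' (l + 1)].
Proof.
move=> Yn0 noY; have [l0 l0Y] := exists_sect Yn0.
have tfY : torsion_free Y by move=> x; apply: no_sect_eigen noY.
have l0n : l0 < n.
  by rewrite ltNge; apply/negP => nl0; apply: l0Y; apply: no_sect_le noY.
(* The degree is raised from [l0] one step at a time; [noY] stops this before n. *)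
have [l [ln lY lY1]] : exists l, [/\ l < n, ~ no_sect Y l & no_sect Y (l + 1)].
  have [d nd] : exists d : nat, n = l0 + d.+1 by exists (absz (n - l0)).-1; lia.
  elim: d => [|d IH] in l0 l0Y l0n nd *; first by exists l0; split=> //; rewrite -[l0 + 1]nd.
  have [lY1|lY1] := pselect (no_sect Y (l0 + 1)); first by exists l0.
  by apply: (IH (l0 + 1)) => //; lia.
have [y0 [y1 [s yn0]]] : exists (y0 : sec0 Y) (y1 : sec1 Y),
    sect l y0 y1 /\ ~ (y0 = 0 /\ y1 = 0).
  apply: contrapT => none; apply: lY => y0 y1 s; apply: contrapT => yn0.
  by apply: none; exists y0, y1.
have fm := line_hom_mono s tfY yn0; have e := coker_exact fm.1 fm.2.
exists l, (coker_coh (line_hom s)), (line_hom s), (coker_proj (line_hom s)).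
by split=> //; apply: no_sect_quotient e lY1.
Qed.

Lemma bounded_mem C n Y : ext_class C -> (forall m, m <= n -> C (O m)) ->
  no_sect Y (n + 1) -> C Y.
Proof.
move=> [_ Cext C0] CO; elim/quotient_ind: Y => Y IH noY.
have [Y0|Yn0] := pselect (is_zero_obj Y); first exact: C0.
have [l [Y' [f [g [ln e noY']]]]] := line_subsheaf Yn0 noY.
apply: (Cext _ _ _ _ _ e); first by apply: CO; lia.
apply: (IH _ _ (short_exact_epi e)); last by apply: no_sect_le noY'; lia.
exact: coker_not_mono (short_exact_comp0 e) (short_exact_mono e) (@line_neq0 k l).
Qed.

Lemma common_annihilator (M : lmodType {poly k}) (N : M -> Prop) : fin_gen M -> submod N ->
  (forall v, exists2 p : {poly k}, p != 0 & N (p *: v)) ->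
  exists2 p : {poly k}, p != 0 & forall v, N (p *: v).
Proof.
move=> [n [g Mg]] Nsub ann.
have /choice[h hP] i : exists p : {poly k}, p != 0 /\ N (p *: g i).
  by have [p p0 Np] := ann (g i); exists p.
exists (\prod_i h i); first by apply/prodf_neq0 => i _; case: (hP i).
move=> v; have [c ->] := Mg v; rewrite scaler_sumr.
have -> : \sum_i (\prod_i h i) *: (c i *: g i) =
    \sum_i (c i * \prod_(j | j != i) h j) *: (h i *: g i).
  by apply: eq_bigr => i _; rewrite !scalerA (bigD1 i) //= mulrC -mulrA [_ * h i]mulrC.
by apply: submod_sum => // i; case: (hP i).
Qed.

(** K maps into the torsion subsheaf X of Y/O(l). By finite generation one nonzero polynomial per
    chart multiplies K into O(l), and these two denominators bound the degrees of its sections. *)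
Lemma torsion_quotient_bounded l Y W (K : coh k) X (f : coh_hom (O l) Y) (p : coh_hom Y W)
    (i : coh_hom K Y) (j : coh_hom X W) :
  short_exact f p -> torsion_free Y -> mono_hom i -> torsion X ->
  (forall v, exists u, hom0 j u = hom0 p (hom0 i v)) ->
  (forall v, exists u, hom1 j u = hom1 p (hom1 i v)) ->
  exists n, no_sect K n.
Proof.
move=> e tfY im [tX0 tX1] ij0 ij1; have fm := short_exact_mono e.
have [[_ e0 _] [_ e1 _] _] := e.
pose w0 := hom0 f (one0 k l); pose w1 := hom1 f (one1 k l).
have ann0 : exists2 q : {poly k}, q != 0 & forall v, exists c : {poly k}, hom0 i (q *: v) = c *: w0.
  apply: (@common_annihilator _ (fun v => exists c : {poly k}, hom0 i v = c *: w0)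
    (sec0_fg K)) => [|v].
    split; first by exists 0; rewrite hom0_0 scale0r.
    move=> q u v [a ua] [b vb]; exists (q * a + b).
    by rewrite linearP ua vb scalerDl scalerA.
  have [u ju] := ij0 v; have [q q0 qu] := tX0 u; exists q => //.
  have /e0[c cq] : hom0 p (hom0 i (q *: v)) = 0 by rewrite !hom0Z -ju -hom0Z qu hom0_0.
  by exists c; rewrite -cq /w0 -hom0Z scale_one0.
have ann1 : exists2 q : {poly k}, q != 0 & forall v, exists c : {poly k}, hom1 i (q *: v) = c *: w1.
  apply: (@common_annihilator _ (fun v => exists c : {poly k}, hom1 i v = c *: w1)
    (sec1_fg K)) => [|v].
    split; first by exists 0; rewrite hom1_0 scale0r.
    move=> q u v [a ua] [b vb]; exists (q * a + b).
    by rewrite linearP ua vb scalerDl scalerA.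
  have [u ju] := ij1 v; have [q q0 qu] := tX1 u; exists q => //.
  have /e1[c cq] : hom1 p (hom1 i (q *: v)) = 0 by rewrite !hom1Z -ju -hom1Z qu hom1_0.
  by exists c; rewrite -cq /w1 -hom1Z scale_one1.
have [p0 p00 p0E] := ann0; have [p1 p10 p1E] := ann1.
have tfK : torsion_free K by move=> x ex; apply: (tfY x); apply: eigen_mono im ex.
(* This degree satisfies the inequality of [sect_degree_bound] with room to spare. *)
exists (l + (size p0)%:Z + (size p1)%:Z) => y0 y1 s.
suff y00 : y0 = 0 by split=> //; apply/(torsion_free_sect tfK s).
have [a aE] := p0E y0; have [b bE] := p1E y1.
have a0 : a = 0.
  apply: (sect_degree_bound _ (hom_sect f (sect_one k l)) (hom_sect i s) _ _ p00 p10 _).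
  - move=> q; rewrite -/w0 -res0Z => /res0_ker/torsion_elt_Xn/(torsion_free0 tfY).
    rewrite -hom0Z -(hom0_0 f) => /fm.1; rewrite scale_one0; exact.
  - by rewrite -hom0Z aE.
  - by rewrite -hom1Z bE.
  - by rewrite ltrDl.
apply: (im.1); rewrite hom0_0; apply: (torsion_free0 tfY); exists p0 => //.
by rewrite -hom0Z aE a0 scale0r.
Qed.

Lemma skyscraper_devissage P C Z : ext_class C -> (forall x, P x -> C (skyscraper x)) ->
  exists X Y (f : coh_hom X Z) (g : coh_hom Z Y),
    [/\ C X, (forall x, P x -> ~ eigen Y x) & short_exact f g].
Proof.
move=> Ccl CP; have [||X [Y [f [g [CX noY e]]]]] :=
  @devissage k (fun S => exists2 x, P x & S = skyscraper x) C Z Ccl.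
- by move=> S [x Px ->]; apply: CP.
- by move=> S [x _ ->]; apply: skyscraper_neq0.
exists X, Y, f, g; split=> // x Px /eigen_sky_hom[i]; apply: noY.
by exists x.
Qed.

Lemma torsion_decomposition Z : exists X Y (f : coh_hom X Z) (g : coh_hom Z Y),
  [/\ torsion X, torsion_free Y & short_exact f g].
Proof.
have [X [Y [f [g [tX noY e]]]]] :=
  @skyscraper_devissage (fun=> True) _ Z (@torsion_class k) (fun x _ => torsion_skyscraper x).
by exists X, Y, f, g; split=> // x; apply: noY.
Qed.

Lemma torsion_free_mem C Y : ext_class C -> (forall m, C (O m)) -> torsion_free Y -> C Y.
Proof.
move=> Ccl CO; have [_ Cext C0] := Ccl; elim/quotient_ind: Y => Y IH tfY.
have [Y0|Yn0] := pselect (is_zero_obj Y); first exact: C0.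
have [l lY] := exists_sect Yn0.
have [y0 [y1 [s yn0]]] : exists (y0 : sec0 Y) (y1 : sec1 Y),
    sect l y0 y1 /\ ~ (y0 = 0 /\ y1 = 0).
  apply: contrapT => none; apply: lY => y0 y1 s; apply: contrapT => yn0.
  by apply: none; exists y0, y1.
have fm := line_hom_mono s tfY yn0; have e := coker_exact fm.1 fm.2.
set f := line_hom s in fm e; set p := coker_proj f in e.
(* Y/O(l) may have torsion, so its torsion-free quotient Q is used for the induction. The kernel K
   of Y -> Q is the saturation of O(l). *)
have [X [Q [j [g [tX tfQ eg]]]]] := torsion_decomposition (coker_coh f).
pose h := comp_hom g p; have [p0 p1] := short_exact_epi e.
have [g0 g1] := short_exact_epi eg.
have he : epi_hom h.
  split=> w; [have [v <-] := g0 w|have [v <-] := g1 w].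
    by have [u <-] := p0 v; exists u.
  by have [u <-] := p1 v; exists u.
have [K [i ei]] : exists K (i : coh_hom K Y), short_exact i h.
  by exists (ker_coh h), (ker_incl h); apply: ker_exact; [apply: he.1|apply: he.2].
have [z0 z1 _] := short_exact_comp0 e.
have hnm : ~ mono_hom h.
  apply: (coker_not_mono _ fm (@line_neq0 k l)); apply: is_zero_homP => m /=.
    by move: (z0 m) => /= ->; rewrite hom0_0.
  by move: (z1 m) => /= ->; rewrite hom1_0.
have [hz0 hz1 _] := short_exact_comp0 ei.
have [[_ eg0 _] [_ eg1 _] _] := eg.
have [N noK] : exists N, no_sect K N.
  apply: (torsion_quotient_bounded e tfY (short_exact_mono ei) tX) => v.
    by apply/eg0; apply: hz0.
  by apply/eg1; apply: hz1.
apply: (Cext _ _ _ _ _ ei); last exact: (IH _ h).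
by apply: (@bounded_mem C (N - 1)) => //; rewrite subrK.
Qed.

Lemma all_mem C Z : ext_class C -> (forall m, C (O m)) -> (forall x, C (skyscraper x)) -> C Z.
Proof.
move=> Ccl CO CS; have [_ Cext C0] := Ccl.
have [X [Y [f [g [tX tfY e]]]]] := torsion_decomposition Z.
apply: (Cext _ _ _ _ _ e); last exact: torsion_free_mem.
(* The support condition of [torsion_torsion_on] for an empty set of excluded points. *)
apply: (@torsion_on_mem k (fun x => ~ False)) => //.
by apply: torsion_torsion_on.
Qed.

(** A line subbundle O(l) of X with torsion-free quotient is all of X: inside O(m) any two sections
    over a chart are proportional, so the quotient is also torsion, hence zero. *)
Lemma mono_hom_line X m (i : coh_hom X (O m)) : mono_hom i -> ~ is_zero_obj X ->
  exists2 l, l <= m & coh_iso (O l) X.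
Proof.
move=> im Xn0; have noX : no_sect X (m + 1).
  by apply: (no_sect_mono im); apply: no_sect_line; rewrite ltrDl.
have [l [X' [f [g [lm e noX']]]]] := line_subsheaf Xn0 noX.
exists l; first by lia.
have [s0 s1] := short_exact_epi e; have fm := short_exact_mono e.
have tfX' : torsion_free X' by move=> x; apply: no_sect_eigen noX'.
have [gf0 gf1 _] := short_exact_comp0 e.
apply: (short_exact_zero_right e); apply: is_zero_homP => v.
  apply: (torsion_free0 tfX').
  pose a : {poly k} := hom0 i (hom0 f (one0 k l)); pose b : {poly k} := hom0 i v.
  exists a.
    apply/eqP => a0; have /eqP : one0 k l = 0.
      by apply: (fm.1); apply: (im.1); rewrite !hom0_0; apply: a0.
    by rewrite oner_eq0.
  have av : a *: v = b *: hom0 f (one0 k l).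
    by apply: (im.1); rewrite !hom0Z; apply: mulrC.
  by rewrite -hom0Z av -hom0Z; apply: gf0.
apply: (torsion_free1 tfX').
pose a : {poly k} := hom1 i (hom1 f (one1 k l)); pose b : {poly k} := hom1 i v.
exists a.
  apply/eqP => a0; have /eqP : one1 k l = 0.
    by apply: (fm.2); apply: (im.2); rewrite !hom1_0; apply: a0.
  by rewrite oner_eq0.
have av : a *: v = b *: hom1 f (one1 k l).
  by apply: (im.2); rewrite !hom1Z; apply: mulrC.
by rewrite -hom1Z av -hom1Z; apply: gf1.
Qed.

(** Once all S_x with x in P are divided out, the remaining torsion is supported outside P and lies
    in D. *)
Lemma decomposition_points P C D Z : ext_class C -> ext_class D ->
  (forall x, P x -> C (skyscraper x)) -> (forall x, ~ P x -> D (skyscraper x)) ->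
  (forall m, D (O m)) ->
  exists X Y (f : coh_hom X Z) (g : coh_hom Z Y), [/\ C X, D Y & short_exact f g].
Proof.
move=> Ccl Dcl CP DP DO; have [_ Dext _] := Dcl.
have [X [Y [f [g [CX noY e]]]]] := skyscraper_devissage Z Ccl CP.
exists X, Y, f, g; split=> //.
have [M [Q [i [p [tM tfQ e']]]]] := torsion_decomposition Y.
apply: (Dext _ _ _ _ _ e'); last exact: torsion_free_mem.
apply: (torsion_on_mem Dcl DP); apply: torsion_torsion_on => // x Px ex.
by apply: (noY x Px); apply: eigen_mono (short_exact_mono e') ex.
Qed.

(** Dividing out O(n + 1) and all simple sheaves is enough: in a torsion-free quotient any nonzero
    morphism from O(n + 1) would be injective, so none is left and [bounded_mem] applies. *)
Lemma decomposition_degree n C D Z : ext_class C -> ext_class D ->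
  (forall x, C (skyscraper x)) -> C (O (n + 1)) -> (forall m, m <= n -> D (O m)) ->
  exists X Y (f : coh_hom X Z) (g : coh_hom Z Y), [/\ C X, D Y & short_exact f g].
Proof.
move=> Ccl Dcl CS CO DO; have [||X [Y [f [g [CX noY e]]]]] :=
  @devissage k (fun S => (exists x, S = skyscraper x) \/ S = O (n + 1)) C Z Ccl.
- by move=> S [[x ->]|->].
- by move=> S [[x ->]|->]; [apply: skyscraper_neq0|apply: line_neq0].
exists X, Y, f, g; split=> //; apply: (bounded_mem Dcl DO) => y0 y1 s.
have tfY : torsion_free Y by move=> x /eigen_sky_hom[i]; apply: noY; left; exists x.
apply: contrapT => yn0; apply: (noY _ (line_hom s)); first by right.
exact: line_hom_mono.
Qed.

End VectorBundles.

(** * Torsion pairs *)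


Section TorsionPairs.
Variable k : closedFieldType.
Implicit Types (E W X Y Z : coh k) (C D T F S : coh k -> Prop) (x : P1 k).

Local Notation O n := (line_bundle k n).

Lemma lperp_class C : ext_class (lperp C).
Proof.
split; [exact: lperp_iso|exact: lperp_ext|].
by move=> E E0 Y _ f; apply: hom_from_zero.
Qed.

Lemma rperp_class C : ext_class (rperp C).
Proof.
split; [exact: rperp_iso|exact: rperp_ext|].
by move=> E E0 Y _ f; apply: hom_to_zero.
Qed.

Lemma generated_class S X : S X -> ext_class (generated S).
Proof.
move=> SX; split; [exact: generated_iso|exact: generated_ext|].
by move=> E; apply: generated_zero SX.
Qed.

Lemma torsion_pair_lperp T F X : torsion_pair T F -> T X <-> lperp F X.
Proof.
move=> [Tiso _ TF dec]; split=> [TX Y FY f|FX]; first exact: TF.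
have [X' [Y [f [g [TX' FY e]]]]] := dec X.
exact: (Tiso _ _ (short_exact_zero_right e (FX _ FY g))).
Qed.

Lemma torsion_pair_rperp T F Y : torsion_pair T F -> F Y <-> rperp T Y.
Proof.
move=> [_ Fiso TF dec]; split=> [FY X TX f|TY]; first exact: TF.
have [X [Y' [f [g [TX FY' e]]]]] := dec Y.
exact: (Fiso _ _ (coh_iso_sym (short_exact_zero_left e (TY _ TX f)))).
Qed.

(** For Z in T decomposed by (C, D), the map onto the D-part goes from T to F, so it is 0 and Z is
    isomorphic to the C-part; dually for F. *)
Lemma torsion_pair_eq T F C D : torsion_pair T F -> iso_closed C -> iso_closed D ->
  (forall X, C X -> T X) -> (forall Y, D Y -> F Y) ->
  (forall Z, exists X Y (f : coh_hom X Z) (g : coh_hom Z Y), [/\ C X, D Y & short_exact f g]) ->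
  same_objects T C /\ same_objects F D.
Proof.
move=> [_ _ TF _] Ciso Diso CT DF dec; split=> Z; split=> [hZ|]; [|exact: CT| |exact: DF].
  have [X [Y [f [g [CX DY e]]]]] := dec Z.
  exact: (Ciso _ _ (short_exact_zero_right e (TF _ _ hZ (DF _ DY) g))).
have [X [Y [f [g [CX DY e]]]]] := dec Z.
exact: (Diso _ _ (coh_iso_sym (short_exact_zero_left e (TF _ _ (CT _ CX) hZ f)))).
Qed.

Lemma generated_sub S C : iso_closed C -> ext_closed C -> summand_closed C ->
  (forall X, S X -> C X) -> forall X, generated S X -> C X.
Proof. by move=> Ci Ce Cs SC X; apply. Qed.

Lemma generated_torsion_pair S S' T F X0 Y0 :
  (forall X Y, S X -> S' Y -> forall f : coh_hom X Y, is_zero_hom f) ->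
  (forall Z, exists X Y (f : coh_hom X Z) (g : coh_hom Z Y),
    [/\ generated S X, generated S' Y & short_exact f g]) ->
  S X0 -> ~ is_zero_obj X0 -> S' Y0 -> ~ is_zero_obj Y0 ->
  same_objects T (generated S) -> same_objects F (generated S') ->
  torsion_pair T F /\ nontrivial_pair T F.
Proof.
move=> SS' dec SX0 X0n0 SY0 Y0n0 TE FE; split; split.
- by move=> X Y XY /TE TX; apply/TE; apply: generated_iso XY _.
- by move=> X Y XY /FE FX; apply/FE; apply: generated_iso XY _.
- move=> X Y /TE TX /FE FY f; move: X TX Y FY f.
  apply: (@generated_sub _ (lperp (generated S'))).
  + exact: lperp_iso.
  + exact: lperp_ext.
  + exact: lperp_summand.
  move=> X SX Y FY.
  (* Orthogonality is extended one argument at a time: the generator X is fixed here while Y ranges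
     over the generated class. *)
  suff : rperp (fun W => W = X) Y by apply.
  apply: (@generated_sub _ (rperp (fun W => W = X)) _ _ _ _ Y FY).
  + exact: rperp_iso.
  + exact: rperp_ext.
  + exact: rperp_summand.
  by move=> W SW _ -> f; apply: SS'.
- move=> Z; have [X [Y [f [g [TX FY e]]]]] := dec Z.
  by exists X, Y, f, g; split=> //; [apply/TE|apply/FE].
- by move=> [_ F0]; apply: Y0n0; apply/F0/FE; apply: generated_mem.
- by move=> [T0 _]; apply: X0n0; apply/T0/TE; apply: generated_mem.
Qed.

Lemma sky_line_hom_zero x n (f : coh_hom (skyscraper x) (O n)) : is_zero_hom f.
Proof. by apply: contrapT => /sky_hom_eigen[_]; apply: line_no_eigen. Qed.

Lemma sky_sky_hom_zero x y (f : coh_hom (skyscraper x) (skyscraper y)) : x <> y -> is_zero_hom f.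
Proof. by move=> xy; apply: contrapT => /sky_hom_eigen[_ /eigen_skyscraper]. Qed.

Lemma line_line_hom_zero m n (f : coh_hom (O m) (O n)) : n < m -> is_zero_hom f.
Proof. by move=> nm; apply: line_hom_zero; apply: no_sect_line. Qed.

Section Classification.
Variables T F : coh k -> Prop.
Hypothesis TF : torsion_pair T F.

Let TP X : T X <-> lperp F X := torsion_pair_lperp X TF.
Let FP Y : F Y <-> rperp T Y := torsion_pair_rperp Y TF.

Lemma torsion_class_of_pair : ext_class T /\ summand_closed T.
Proof.
have -> : T = lperp F by apply/funext => X; apply/propext.
by split; [apply: lperp_class|apply: lperp_summand].
Qed.

Lemma torsion_free_class_of_pair : ext_class F /\ summand_closed F.
Proof.
have -> : F = rperp T by apply/funext => X; apply/propext.
by split; [apply: rperp_class|apply: rperp_summand].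
Qed.

Lemma pair_no_sect m Y : T (O m) -> F Y -> no_sect Y m.
Proof. by move=> /TP TO FY; apply: no_sectP => f; apply: TO. Qed.

(** A sheaf in F has no morphisms from O(m), hence none from O(n) by [no_sect_le]; membership in T
    is orthogonality to F. *)
Lemma pair_line_up m n : m <= n -> T (O m) -> T (O n).
Proof.
move=> mn TO; apply/TP => Y FY f; apply: line_hom_zero.
exact: no_sect_le mn (pair_no_sect TO FY).
Qed.

Lemma pair_skyscraper m x : T (O m) -> T (skyscraper x).
Proof.
move=> TO; apply/TP => Y FY f; apply: contrapT => /sky_hom_eigen[_].
exact: no_sect_eigen (pair_no_sect TO FY).
Qed.

Lemma pair_line_free m : (forall l, l <= m -> ~ T (O l)) -> F (O m).
Proof.
move=> noT; have [Tiso Fiso _ dec] := TF.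
have [X [Y [f [g [TX FY e]]]]] := dec (O m).
have [X0|Xn0] := pselect (is_zero_obj X).
  exact: (Fiso _ _ (coh_iso_sym (short_exact_zero_left e (hom_from_zero f X0)))).
have [l lm lX] := mono_hom_line (short_exact_mono e) Xn0.
by case: (noT l lm); apply: (Tiso _ _ (coh_iso_sym lX)).
Qed.

(* A nonzero morphism out of a simple sheaf is injective, so composites
   [X -> S_x -> Y] of nonzero morphisms are nonzero. *)
Lemma pair_skyscraper_free x : ~ T (skyscraper x) -> F (skyscraper x).
Proof.
move=> noT; apply/FP => X TX f; apply: contrapT => fn0; apply: noT.
apply/TP => Y FY g; apply: contrapT => gn0; apply: fn0.
have [[i0 i1] _] := sky_hom_eigen gn0.
have [z0 z1 _] := (FP Y).1 FY X TX (comp_hom g f).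
apply: is_zero_homP => m; [apply: (i0)|apply: (i1)].
  by rewrite hom0_0; apply: z0.
by rewrite hom1_0; apply: z1.
Qed.

Lemma pair_zero_of_all : (forall Z, F Z) ->
  same_objects T (@is_zero_obj k) /\ same_objects F (fun=> True).
Proof.
move=> Fall; have [[_ _ T0] _] := torsion_class_of_pair.
split=> X; split=> // TX; last exact: T0.
have [z0 z1 _] := (TP X).1 TX X (Fall X) (id_hom X).
by apply: is_zero_objP => m; [apply: z0|apply: z1].
Qed.

Lemma pair_all_of_zero : (forall Z, T Z) ->
  same_objects T (fun=> True) /\ same_objects F (@is_zero_obj k).
Proof.
move=> Tall; have [[_ _ F0] _] := torsion_free_class_of_pair.
split=> X; split=> // FX; last exact: F0.
have [z0 z1 _] := (FP X).1 FX X (Tall X) (id_hom X).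
by apply: is_zero_objP => m; [apply: z0|apply: z1].
Qed.

End Classification.
End TorsionPairs.

Theorem proposition6p5 (k : closedFieldType) (T F : coh k -> Prop) :
  (torsion_pair T F /\ nontrivial_pair T F) <->
  ((exists P : P1 k -> Prop,
      (exists x : P1 k, P x) /\
      same_objects T
        (generated (fun E => exists2 x : P1 k, P x & E = skyscraper x)) /\
      same_objects F
        (generated (fun E =>
           (exists m : int, E = line_bundle k m) \/
           (exists2 x : P1 k, ~ P x & E = skyscraper x)))) \/
   (exists n : int,
      same_objects T
        (generated (fun E =>
           (exists2 m : int, n < m & E = line_bundle k m) \/
           (exists x : P1 k, E = skyscraper x))) /\
      same_objects F
        (generated (fun E =>
           exists2 m : int, m <= n & E = line_bundle k m)))).
Proof.
split; last first.
  case=> [[P [[x0 Px0] [TE FE]]]|[n [TE FE]]].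
    have S0 : exists2 x, P x & skyscraper x0 = skyscraper x by exists x0.
    have S0' : (exists m, line_bundle k 0 = line_bundle k m) \/
      (exists2 x, ~ P x & line_bundle k 0 = skyscraper x) by left; exists 0.
    apply: (generated_torsion_pair _ _ S0 (@skyscraper_neq0 k x0) S0' (@line_neq0 k 0) TE FE).
      move=> X Y [x Px ->] [[m ->]|[y nPy ->]] f; first exact: sky_line_hom_zero.
      by apply: sky_sky_hom_zero => xy; apply: nPy; rewrite -xy.
    move=> Z; apply: (decomposition_points (P := P)).
    - exact: generated_class S0.
    - exact: generated_class S0'.
    - by move=> x Px; apply: generated_mem; exists x.
    - by move=> x Px; apply: generated_mem; right; exists x.
    - by move=> m; apply: generated_mem; left; exists m.
  have S0 : (exists2 m, n < m & line_bundle k (n + 1) = line_bundle k m) \/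
    (exists x : P1 k, line_bundle k (n + 1) = skyscraper x).
    by left; exists (n + 1); rewrite ?ltrDl.
  have S0' : exists2 m, m <= n & line_bundle k n = line_bundle k m by exists n.
  apply: (generated_torsion_pair _ _ S0 (@line_neq0 k (n + 1)) S0' (@line_neq0 k n) TE FE).
    move=> X Y [[m nm ->]|[x ->]] [l ln ->] f; last exact: sky_line_hom_zero.
    by apply: line_line_hom_zero; apply: le_lt_trans nm.
  move=> Z; apply: (decomposition_degree (n := n)).
  - exact: generated_class S0.
  - exact: generated_class S0'.
  - by move=> x; apply: generated_mem; right; exists x.
  - exact: generated_mem.
  - by move=> m mn; apply: generated_mem; exists m.
move=> [TF [nontop nonbot]].
have [Tcl Tsum] := torsion_class_of_pair TF; have [Tiso Text T0] := Tcl.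
have [Fcl Fsum] := torsion_free_class_of_pair TF; have [Fiso Fext F0] := Fcl.
have [[m Tm]|noT] := pselect (exists m, T (line_bundle k m)).
  right; have TS x := pair_skyscraper TF x Tm.
  (* Without such a jump, T contains line bundles of arbitrarily small degree, hence all of them,
     and the pair is trivial. *)
  have [n [Tn1 Tn]] : exists n, T (line_bundle k (n + 1)) /\ ~ T (line_bundle k n).
    apply: contrapT => none; apply: nontop; apply: (pair_all_of_zero TF) => Z.
    apply: (all_mem Z Tcl _ TS) => l.
    have Tdown d : T (line_bundle k (m - d%:Z)).
      elim: d => [|d IH]; first by rewrite subr0.
      apply: contrapT => nT; apply: none; exists (m - d.+1%:Z); split=> //.
      by have -> : m - d.+1%:Z + 1 = m - d%:Z by lia.
    apply: (pair_line_up TF _ (Tdown (absz (m - l)))); lia.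
  have FO l : l <= n -> F (line_bundle k l).
    move=> ln; apply: (pair_line_free TF) => j jl Tj; apply: Tn.
    by apply: (pair_line_up TF _ Tj); apply: le_trans ln.
  exists n; apply: (torsion_pair_eq TF); try exact: generated_iso.
  - apply: generated_sub => // X [[l nl ->]|[x ->]]; last exact: TS.
    by apply: (pair_line_up TF _ Tn1); lia.
  - by apply: generated_sub => // X [l ln ->]; apply: FO.
  - move=> Z; apply: (decomposition_degree (n := n)).
    + apply: (@generated_class _ _ (line_bundle k (n + 1))); left.
      by exists (n + 1); rewrite ?ltrDl.
    + by apply: (@generated_class _ _ (line_bundle k n)); exists n.
    + by move=> x; apply: generated_mem; right; exists x.
    + by apply: generated_mem; left; exists (n + 1); rewrite ?ltrDl.
    + by move=> l ln; apply: generated_mem; exists l.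
have FO l : F (line_bundle k l).
  by apply: (pair_line_free TF) => j _ Tj; apply: noT; exists j.
(* The set P is forced by which simple sheaves lie in T. If it were empty, F would contain all line
   bundles and all simple sheaves, hence everything. *)
left; exists (fun x => T (skyscraper x)).
have [x0 Tx0] : exists x, T (skyscraper x).
  apply: contrapT => none; apply: nonbot; apply: (pair_zero_of_all TF) => Z.
  apply: all_mem => // x; apply: (pair_skyscraper_free TF) => Tx.
  by apply: none; exists x.
split; first by exists x0.
apply: (torsion_pair_eq TF); try exact: generated_iso.
- by apply: generated_sub => // X [x Tx ->].
- by apply: generated_sub => // X [[l ->] //|[x nTx ->]]; apply: (pair_skyscraper_free TF).
- move=> Z; apply: (decomposition_points (P := fun x => T (skyscraper x))).
  + by apply: (@generated_class _ _ (skyscraper x0)); exists x0.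
  + by apply: (@generated_class _ _ (line_bundle k 0)); left; exists 0.
  + by move=> x Tx; apply: generated_mem; exists x.
  + by move=> x nTx; apply: generated_mem; right; exists x.
  + by move=> l; apply: generated_mem; left; exists l.
Qed.
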